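(* Let $m \ge 1$, $C > 0$, $s \in \mathbb{N}$ and $\alpha \in (0,1]$. There exist $\gamma_1, \gamma_2 > 0$ and a constant $K > 0$, depending only on $m, C, s, \alpha$, such that the following holds. Let $G_1$ and $G_2$ be finite abelian groups, let $a_1, \dots, a_m : G_2 \to G_1$ be functions, and let $\delta_1, \delta_2 \ge 0$. Suppose that (i) for any $l \in \{1, \dots, m\}$, any $f_1, \dots, f_l : G_1 \to \mathbb{D}$, and any $\chi_{l+1}, \dots, \chi_m \in \hat{G}_1$, $$\left\| \mathbb{E}_{y \in G_2} \prod_{i=1}^l f_i(x + a_i(y)) \prod_{j=l+1}^m \chi_j(a_j(y)) \right\|_{L^2(G_1)} \le C \|f_l\|_{U^s(G_1)}^{\alpha} + \delta_1,$$ and (ii) for any $\chi_1, \dots, \chi_m \in \hat{G}_1$, not all the trivial character, $$\left| \mathbb{E}_{y \in G_2} \prod_{i=1}^m \chi_i(a_i(y)) \right| \le \delta_2.$$ Then for any $f_1, \dots, f_m : G_1 \to \mathbb{D}$, $$\left\| \mathbb{E}_{y \in G_2} \prod_{i=1}^m f_i(x + a_i(y)) - \prod_{i=1}^m \mathbb{E}_{z \in G_1} f_i(z) \right\|_{L^2(G_1)} \le K \left( \delta_1^{\gamma_1} + \delta_2^{\gamma_2} \right).$$ All $L^2(G_1)$-norms are taken with respect to the variable $x \in G_1$.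
   Context: $\mathbb{D} = \{z \in \mathbb{C} : |z| \le 1\}$. For a finite set $S$ and $f : S \to \mathbb{C}$, $\mathbb{E}_{x \in S} f(x) = \frac{1}{|S|} \sum_{x \in S} f(x)$ and $\|f\|_{L^2(S)} = (\mathbb{E}_{x \in S} |f(x)|^2)^{1/2}$. For a finite abelian group $G$, $\hat{G}$ is the group of characters (homomorphisms $G \to \{z \in \mathbb{C} : |z| = 1\}$). For $f : G \to \mathbb{C}$ and $h \in G$, $\Delta_h f(x) = f(x+h)\overline{f(x)}$, and for $\mathbf{h} = (h_1, \dots, h_s) \in G^s$, $\Delta_{\mathbf{h}} f = \Delta_{h_1} \cdots \Delta_{h_s} f$. The Gowers (semi)norm is $\|f\|_{U^s(G)} = \left( \mathbb{E}_{\mathbf{h} \in G^s} \mathbb{E}_{x \in G} \Delta_{\mathbf{h}} f(x) \right)^{1/2^s}$ for $s \ge 1$; in particular $\|f\|_{U^1(G)} = |\mathbb{E}_{x \in G} f(x)|$. *)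

(* Defs.v *)
From HB Require Import structures.
From mathcomp Require Import all_boot all_order all_algebra.
From mathcomp Require Import complex.
From mathcomp Require Import reals exp.

Set Implicit Arguments.
Unset Strict Implicit.
Unset Printing Implicit Defensive.

Import Order.TTheory GRing.Theory Num.Theory.
Import ComplexField.

Local Open Scope ring_scope.

Definition expect (K : fieldType) (S : finType) (f : S -> K) : K :=
  (#|S|%:R)^-1 * \sum_(x : S) f x.

Notation "\E_ ( x 'in' S ) F" := (expect (fun x : S => F))
  (at level 36, F at level 36, x at level 50,
   format "\E_ ( x  'in'  S )  F") : ring_scope.

(* [normc] is the modulus with values in [R]; the norm [`|z|] of [R[i]] is
   itself an element of [R[i]]. *)
Definition L2norm (R : realType) (S : finType) (f : S -> R[i]) : R :=
  Num.sqrt (\E_(x in S) (Normc.normc (f x)) ^+ 2).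

Definition disk_valued (R : realType) (S : Type) (f : S -> R[i]) : Prop :=
  forall x, Normc.normc (f x) <= 1.

Definition is_character (R : realType) (G : finZmodType) (chi : G -> R[i]) :
    Prop :=
  (forall x y, chi (x + y) = chi x * chi y) /\
  (forall x, Normc.normc (chi x) = 1).

Definition mulderiv (R : realType) (G : finZmodType) (h : G) (f : G -> R[i]) :
    G -> R[i] :=
  fun x => f (x + h) * conjc (f x).

Definition mulderivs (R : realType) (G : finZmodType) (hs : seq G)
    (f : G -> R[i]) : G -> R[i] :=
  foldr (@mulderiv R G) f hs.

Definition gowers_avg (R : realType) (G : finZmodType) (s : nat)
    (f : G -> R[i]) : R[i] :=
  \E_(h in s.-tuple G) \E_(x in G) mulderivs h f x.

(* For [0 < s] the average is a nonnegative real ([gowers_avg_ge0]), so that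
   taking its real part loses nothing; [s = 0] is not meaningful. *)
Definition gowers_norm (R : realType) (G : finZmodType) (s : nat)
    (f : G -> R[i]) : R :=
  complex.Re (gowers_avg s f) `^ ((2 ^ s)%:R^-1).

Lemma expect_mulderiv (R : realType) (G : finZmodType) (g : G -> R[i]) :
  \E_(h in G) \E_(x in G) mulderiv h g x = `|\E_(x in G) g x| ^+ 2.
Proof.
rewrite sqr_normc /expect -mulr_sumr exchange_big /=.
rewrite rmorphM fmorphV rmorph_nat rmorph_sum /= [LHS]mulrA mulrACA.
congr (_ * _); rewrite mulr_sumr; apply: eq_bigr => x _.
rewrite /mulderiv -mulr_suml; congr (_ * _).
by rewrite [RHS](reindex_inj (addrI x)).
Qed.

Lemma gowers_avgS (R : realType) (G : finZmodType) (s : nat) (f : G -> R[i]) :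
  gowers_avg s.+1 f =
  \E_(h in s.-tuple G) `|\E_(x in G) mulderivs h f x| ^+ 2.
Proof.
rewrite /gowers_avg [RHS]/expect.
under [X in _ = _ * X]eq_bigr do rewrite -expect_mulderiv /expect.
rewrite -mulr_sumr {1}/expect !card_tuple expnS natrM invfM.
rewrite -[LHS]mulrA [LHS]mulrCA; congr (_ * (_ * _)).
rewrite (reindex (fun p : G * s.-tuple G => cons_tuple p.1 p.2)) /=.
  by rewrite exchange_big pair_bigA.
exists (fun t => (thead t, [tuple of behead t])) => [[x t]|t] _ /=.
  by congr pair; apply: val_inj.
by rewrite [RHS]tuple_eta; apply: val_inj.
Qed.

Lemma gowers_avg_ge0 (R : realType) (G : finZmodType) (s : nat)
    (f : G -> R[i]) : (0 < s)%N -> 0 <= gowers_avg s f.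
Proof.
case: s => // s _; rewrite gowers_avgS mulr_ge0 ?invr_ge0 ?ler0n//.
by apply: sumr_ge0 => h _; rewrite exprn_ge0.
Qed.

(* Main.v *)
Require Import Defs.
From HB Require Import structures.
From mathcomp Require Import all_boot all_order all_algebra.
From mathcomp Require Import complex.
From mathcomp Require Import reals exp.
From mathcomp Require Import fingroup cyclic separable cyclotomic.
From mathcomp Require Import ring lra.
From mathcomp Require Import boolp.

Set Implicit Arguments.
Unset Strict Implicit.
Unset Printing Implicit Defensive.

Import Order.TTheory GRing.Theory Num.Theory.
Import ComplexField.

Local Open Scope complex_scope.
Local Open Scope ring_scope.

(** Why the theorem holds.  Put [d = max(delta1, delta2)]; only [d <= 1]
    matters, since the left-hand side is at most 2.  One proves by induction on
    [l] that the average of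
      [f_1(x + a_1(y)) .. f_l(x + a_l(y)) chi_{l+1}(a_{l+1}(y)) .. chi_m(a_m(y))]
    is within [O(d^c)] in [L^2] of [E f_1 .. E f_l], times 1 or 0 according to
    whether all the remaining characters are trivial ([mixed_avg_bound]).  The case
    [l = 0] is the equidistribution hypothesis on characters, and the case
    [l = m] is the theorem.

    For the inductive step, call [T g] the average with [g] in the place of the
    last function.  Splitting that function into its mean and the rest, the mean
    is dealt with by the previous case (a constant is a multiple of the trivial
    character), so everything reduces to showing that [T g] is small when
    [E g = 0] ([mean_zero_bound]).  Let [D = E_y G_y] be the dual function,
    characterised by [<u, D> = <T u, T g>] for all [u]
    (with [<u, v>] the mean of [u] times the conjugate of [v]), and put
    [D' = (D - E D) / 2].
    Two applications of Cauchy-Schwarz give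
      [|T g|_2^4 <= 4 E |D'|^2] and [2 E |D'|^2 <= |T D'|_2],
    so by the hypothesis that [U^s] norms control [T] it is enough to show that
    the [U^s] norm of [D'] is small.  As [E D' = 0], its [U^1] norm vanishes,
    and what remains is to lower the degree: to bound the [U^{t+2}] norm of [D']
    by its [U^{t+1}] norm and a small error ([degree_lowering_step], iterated in [degree_lowering]).

    For that step, write the [U^{t+2}] norm as an average over [h] in [G^t] of
    the [U^2] norms of [Delta_h D'], and use the inverse theorem for [U^2] to get
    characters [chi_h] which correlate with [Delta_h D'] ([U2_inverse]).  In
    [Delta_h D'] only the vertex [D'(x + h_1 + .. + h_t)] of the cube, itself an
    average over [y], depends on all coordinates of [h], so a Gowers-Cauchy-Schwarz
    inequality ([box_CS]) removes all the other ones, and leaves correlations of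
    the alternating products over boxes of the averaged functions with the
    characters
      [phi_{h,h'}(x) = prod_omega chi_{h^omega}(x)^{+-1}].
    By the previous case of the main induction (with [phi_{h,h'}] as the next
    character) these correlations are small unless [phi_{h,h'}] is trivial.  When
    it is trivial, [chi_h] equals a product of functions which, for fixed [h'],
    each ignore one of the coordinates of [h].  Such phases can again be
    removed by [box_CS], which leaves the [U^{t+1}] norm ([twisted_gowers_le]). *)

(** * Averages over finite sets *)

Section Averages.
Variable K : numFieldType.
Implicit Types S T : finType.

Lemma eq_expect S (f g : S -> K) : f =1 g -> \E_(x in S) f x = \E_(x in S) g x.
Proof. by move=> fg; rewrite /expect (eq_bigr _ (fun x _ => fg x)). Qed.

Lemma expectD S (f g : S -> K) :
  \E_(x in S) (f x + g x) = \E_(x in S) f x + \E_(x in S) g x.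
Proof. by rewrite /expect big_split mulrDr. Qed.

Lemma expectMl S (c : K) (f : S -> K) :
  \E_(x in S) (c * f x) = c * \E_(x in S) f x.
Proof. by rewrite /expect -mulr_sumr mulrCA. Qed.

Lemma expectMr S (c : K) (f : S -> K) :
  \E_(x in S) (f x * c) = (\E_(x in S) f x) * c.
Proof. by rewrite /expect -mulr_suml mulrA. Qed.

Lemma expectB S (f g : S -> K) :
  \E_(x in S) (f x - g x) = \E_(x in S) f x - \E_(x in S) g x.
Proof. by rewrite /expect big_split sumrN mulrDr mulrN. Qed.

Lemma exchange_expect S T (f : S -> T -> K) :
  \E_(x in S) \E_(y in T) f x y = \E_(y in T) \E_(x in S) f x y.
Proof.
by rewrite /expect -!mulr_sumr exchange_big /= mulrCA.
Qed.

Lemma expect_pair S T (f : S * T -> K) :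
  \E_(p in (S * T)%type) f p = \E_(x in S) \E_(y in T) f (x, y).
Proof.
rewrite /expect -mulr_sumr pair_bigA /= card_prod natrM invfM mulrA.
by congr (_ * _); apply: eq_bigr => -[].
Qed.

Lemma expect_cst S (x0 : S) (c : K) : \E_(x in S) c = c.
Proof.
rewrite /expect sumr_const -[c *+ _]mulr_natl mulrA mulVf ?mul1r //.
by rewrite pnatr_eq0 -lt0n; apply/card_gt0P; exists x0.
Qed.

Lemma expect_bij S T (s : T -> S) (f : S -> K) :
  bijective s -> \E_(x in T) f (s x) = \E_(x in S) f x.
Proof.
move=> bs; rewrite /expect (bij_eq_card bs); congr (_ * _).
by case: bs => s' ss' s's; rewrite [RHS](reindex s) //; exists s' => x _.
Qed.

Lemma le_expect S (f g : S -> K) :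
  (forall x, f x <= g x) -> \E_(x in S) f x <= \E_(x in S) g x.
Proof.
by move=> fg; apply: ler_wpM2l; [rewrite invr_ge0 ler0n|exact: ler_sum].
Qed.

Lemma expect_ge0 S (f : S -> K) : (forall x, 0 <= f x) -> 0 <= \E_(x in S) f x.
Proof.
by move=> f0; rewrite mulr_ge0 ?invr_ge0 ?ler0n//; apply: sumr_ge0.
Qed.

Lemma norm_expect S (f : S -> K) : `|\E_(x in S) f x| <= \E_(x in S) `|f x|.
Proof.
rewrite /expect normrM ger0_norm ?invr_ge0 ?ler0n//.
by apply: ler_wpM2l; [rewrite invr_ge0 ler0n|exact: ler_norm_sum].
Qed.

Lemma expect_le_cst S (c : K) (f : S -> K) :
  0 <= c -> (forall x, f x <= c) -> \E_(x in S) f x <= c.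
Proof.
move=> c0 fc; case: (pickP (fun _ : S => true)) => [x0 _|S0].
  by apply: (le_trans (le_expect fc)); rewrite expect_cst.
by rewrite /expect (eq_card0 S0) invr0 mul0r.
Qed.

Lemma norm_expect_le S (c : K) (f : S -> K) :
  0 <= c -> (forall x, `|f x| <= c) -> `|\E_(x in S) f x| <= c.
Proof. by move=> c0 fc; apply: (le_trans (norm_expect f)); apply: expect_le_cst. Qed.

(** The variance [E (f - E f)^2] is nonnegative. *)
Lemma jensen_sqr S (f : S -> K) : (forall x, 0 <= f x) ->
  (\E_(x in S) f x) ^+ 2 <= \E_(x in S) f x ^+ 2.
Proof.
move=> f0; set m := \E_(x in S) f x.
case: (pickP (fun _ : S => true)) => [x0 _|S0]; last first.
  by rewrite /m /expect (eq_card0 S0) invr0 !mul0r expr0n.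
have m0 : 0 <= m by apply: expect_ge0.
rewrite -subr_ge0.
have -> : \E_(x in S) f x ^+ 2 - m ^+ 2 = \E_(x in S) (f x - m) ^+ 2.
  rewrite [RHS](eq_expect (g := fun x => f x ^+ 2 - m *+ 2 * f x + m ^+ 2)).
    rewrite expectD expectB expectMl expect_cst // -/m; ring.
  by move=> x /=; ring.
by apply: expect_ge0 => x; rewrite real_exprn_even_ge0 // realB // ger0_real.
Qed.

(** All the uses of the Cauchy-Schwarz inequality below have one bounded factor
    and thus reduce to this form of it, whose exponents are powers of 2. *)
Lemma jensen S (n : nat) (f : S -> K) : (forall x, 0 <= f x) ->
  (\E_(x in S) f x) ^+ (2 ^ n) <= \E_(x in S) f x ^+ (2 ^ n).
Proof.
elim: n f => [|n IH] f f0; first by rewrite expr1 le_refl.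
rewrite expnS exprM; apply: le_trans (_ : (\E_(x in S) f x ^+ 2) ^+ (2 ^ n) <= _).
  by rewrite lerXn2r ?jensen_sqr// nnegrE ?exprn_ge0 ?expect_ge0// => x; rewrite exprn_ge0.
apply: le_trans (IH _ _) _ => [x|]; first by rewrite exprn_ge0.
by apply: le_expect => x; rewrite -exprM.
Qed.

Lemma jensen_norm S (n : nat) (f : S -> K) :
  `|\E_(x in S) f x| ^+ (2 ^ n) <= \E_(x in S) `|f x| ^+ (2 ^ n).
Proof.
apply: le_trans (jensen n (fun x => normr_ge0 (f x))).
by rewrite lerXn2r ?norm_expect// nnegrE // expect_ge0.
Qed.

Lemma expect_tupleS S (n : nat) (f : seq S -> K) :
  \E_(h in n.+1.-tuple S) f h = \E_(a in S) \E_(h in n.-tuple S) f (a :: h).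
Proof.
rewrite -(expect_pair (fun p : S * n.-tuple S => f (p.1 :: p.2))).
rewrite -[LHS](@expect_bij _ _ (fun p : S * n.-tuple S => cons_tuple p.1 p.2)) //.
exists (fun t => (thead t, [tuple of behead t])) => [[x t]|t] /=.
  by congr pair; apply: val_inj.
by rewrite [RHS]tuple_eta; apply: val_inj.
Qed.

Lemma expect_tuple0 S (f : seq S -> K) : \E_(h in 0.-tuple S) f h = f [::].
Proof.
rewrite -[RHS](@expect_cst _ ([tuple] : 0.-tuple S)).
by apply: eq_expect => h; rewrite tuple0.
Qed.

End Averages.

(** * Characters of a finite abelian group and the inverse theorem for [U^2] *)

Lemma finite_order_diagonalizable (F : closedFieldType) (n k : nat) (A : 'M[F]_n.+1) :
  k%:R != 0 :> F -> A ^+ k = 1 -> diagonalizable A.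
Proof.
move=> k0 Ak; apply/diagonalizableP.
have k_gt0 : (0 < k)%N by case: k k0 {Ak} => //; rewrite eqxx.
have [rs Drs] := closed_field_poly_normal ('X^k - 1 : {poly F}).
have mon : lead_coef ('X^k - 1 : {poly F}) = 1 by apply/monicP; rewrite -polyC1 monicXnsubC.
rewrite mon scale1r in Drs.
exists rs; first by rewrite -separable_prod_XsubC -Drs separable_Xn_sub_1.
by rewrite -Drs mxminpoly_min // rmorphB rmorphXn /= horner_mx_X rmorph1 Ak subrr.
Qed.

Lemma mulrn_card (X : finZmodType) (x : X) : x *+ #|X| = 0.
Proof.
have := @expg_cardG X [set: X]%G x (in_setT _).
by rewrite cardsT FinRing.zmodXgE.
Qed.


(** The translations of [X] are commuting matrices of finite order, hence
    simultaneously diagonalizable; the [v i] are a basis of joint eigenvectors.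
    Normalised by [v i 0 = 1], they are the characters of [X]. *)
Lemma translation_eigenbasis (F : closedFieldType) (X : finZmodType) (n : nat)
    (e : 'I_n -> X) :
  bijective e -> #|X|%:R != 0 :> F ->
  exists v : 'I_n -> X -> F,
    (forall i g, exists d : F, forall x, v i (x + g) = d * v i x) /\
    \det (\matrix_(i, j) v i (e j)) != 0.
Proof.
move=> [r eK rK] X0.
have : (0 < n)%N by move: (r 0) => [k kn]; apply: leq_ltn_trans kn.
case: n e r eK rK => // n e r eK rK _.
have e_inj := can_inj eK.
(* Acting on row vectors, [T g] is the translation of functions by [g] ([rT]). *)
pose T (g : X) : 'M[F]_n.+1 := \matrix_(i, j) (e i == e j + g)%:R.
have rT (u : 'rV[F]_n.+1) g j : (u *m T g) 0 j = u 0 (r (e j + g)).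
  rewrite mxE (bigD1 (r (e j + g))) //= mxE rK eqxx mulr1 big1 ?addr0 // => k ne.
  rewrite mxE; case: eqP => [ek|]; last by rewrite mulr0.
  by rewrite -ek eK eqxx in ne.
have TD g h : T g * T h = T (h + g).
  apply/row_matrixP => i; rewrite -mulmxE row_mul; apply/rowP => j.
  by rewrite rT !mxE rK -addrA.
have T0 : T 0 = 1.
  apply/matrixP => i j; rewrite !mxE addr0 (inj_eq e_inj) //.
have TX g k : T g ^+ k = T (g *+ k).
  by elim: k => [|k IH]; rewrite ?expr0 ?T0 // exprS IH TD mulrSr.
have [P Pu /allP Pdiag] : codiagonalizable [seq T g | g : X].
  apply/codiagonalizableP; split=> [_ _ /mapP[g _ ->] /mapP[h _ ->]|_ /mapP[g _ ->]].
    by rewrite /comm_mx !mulmxE !TD addrC.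
  by apply: (finite_order_diagonalizable X0); rewrite TX mulrn_card T0.
exists (fun i x => P i (r x)); split=> [i g|]; last first.
  rewrite -unitfE -unitmxE; suff -> : \matrix_(i, j) P i (r (e j)) = P by [].
  by apply/matrixP => i j; rewrite mxE eK.
have /Pdiag/diagonalizable_forPex[d /(simmxP Pu) dP] : T g \in [seq T g | g : X].
  exact: image_f.
exists (d 0 i) => x.
have rowPT : (P *m T g) i (r x) = P i (r (x + g)).
  have -> : (P *m T g) i (r x) = row i (P *m T g) 0 (r x) by rewrite [RHS]mxE.
  by rewrite row_mul rT rK mxE.
by rewrite -rowPT dP mul_diag_mx mxE.
Qed.

Section Characters.
Variables (R : realType) (X : finZmodType).
Local Notation C := R[i].

Lemma norm_normc (z : C) : `|z| = (Normc.normc z)%:C.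
Proof. by rewrite normc_def; case: z. Qed.

Lemma is_characterP (chi : X -> C) :
  is_character chi <->
  (forall x y, chi (x + y) = chi x * chi y) /\ (forall x, `|chi x| = 1).
Proof.
split=> -[chiD chi1]; split=> // x; first by rewrite norm_normc chi1.
by apply: complexI; rewrite -norm_normc chi1.
Qed.

Lemma expect_shift (f : X -> C) (a : X) : \E_(x in X) f (x + a) = \E_(x in X) f x.
Proof.
by apply: expect_bij; exists (fun x => x - a) => x; rewrite ?addrK ?subrK.
Qed.

(** Translating by [g] multiplies the mean by [chi g], which differs from 1. *)
Lemma expect_character (chi : X -> C) (g : X) :
  is_character chi -> chi g != 1 -> \E_(x in X) chi x = 0.
Proof.
move=> /is_characterP[chiD _] g1.
have : \E_(x in X) chi x = (\E_(x in X) chi x) * chi g.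
  by rewrite -expectMr -[LHS](expect_shift _ g); apply: eq_expect => x; rewrite chiD.
move/eqP; rewrite -subr_eq0 -{1}[\E_(x in X) _]mulr1 -mulrBr mulf_eq0 subr_eq0.
by rewrite [1 == _]eq_sym (negPf g1) orbF => /eqP.
Qed.

Lemma characterM (chi psi : X -> C) : is_character chi -> is_character psi ->
  is_character (fun x => chi x * psi x).
Proof.
move=> /is_characterP[cD c1] /is_characterP[pD p1]; apply/is_characterP; split=> x.
  by move=> y; rewrite cD pD mulrACA.
by rewrite normrM c1 p1 mulr1.
Qed.

Lemma characterC (chi : X -> C) : is_character chi -> is_character (fun x => conjc (chi x)).
Proof.
move=> /is_characterP[cD c1]; apply/is_characterP; split=> x.
  by move=> y; rewrite cD rmorphM.
by rewrite normcJ c1.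
Qed.

(** An eigenvector of all translations is determined by its value at 0 and by
    its eigenvalues, so it is nonzero at 0 and, once normalised, is
    multiplicative; its values are roots of unity as [X] is finite.  Two equal
    characters would give two equal rows in the nonsingular matrix of the
    eigenbasis. *)
Lemma character_basis : exists (n : nat) (e : 'I_n -> X) (chi : 'I_n -> X -> C),
  [/\ bijective e, forall i, is_character (chi i) &
      forall i j, i != j -> exists g, chi i g != chi j g].
Proof.
have X0 : #|X|%:R != 0 :> C by rewrite pnatr_eq0 -lt0n; apply/card_gt0P; exists 0.
pose e (i : 'I_#|X|) : X := enum_val i.
have eb : bijective e by exists enum_rank; [exact: enum_valK|exact: enum_rankK].
have [v [vP detv]] := translation_eigenbasis eb X0.
have v0 i : v i 0 != 0.
  apply: contraNneq detv => vi0.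
  rewrite (expand_det_row _ i) big1 // => j _; rewrite mxE.
  by have [d dP] := vP i (e j); rewrite -[e j]add0r dP vi0 mulr0 mul0r.
have vD i x g : v i (x + g) = v i g / v i 0 * v i x.
  have [d dP] := vP i g; rewrite dP -[in RHS](add0r g) dP mulfK //.
exists #|X|, e, (fun i x => v i x / v i 0); split=> // [i|i j ij].
  have chiD x y : v i (x + y) / v i 0 = v i x / v i 0 * (v i y / v i 0).
    by rewrite vD -mulrA mulrC.
  apply/is_characterP; split=> // x.
  have chiM k : v i (x *+ k) / v i 0 = (v i x / v i 0) ^+ k.
    by elim: k => [|k IH]; rewrite ?mulr0n ?expr0 ?divff // mulrSr chiD IH exprSr.
  have := chiM #|X|; rewrite mulrn_card divff // => /(congr1 Num.norm).
  rewrite normr1 normrX => /esym/eqP; rewrite pexpr_eq1 ?normr_ge0 //; last first.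
    by apply/card_gt0P; exists 0.
  by move/eqP.
apply: contrapT => nex.
have same g : v i g / v i 0 = v j g / v j 0.
  by apply/eqP; apply: contrapT => /negP ne; apply: nex; exists g.
move: detv; rewrite -(@det_tr _ _ (\matrix_(i, j) _)).
set M := (_^T); suff -> : \det M = 0 by rewrite eqxx.
pose M' := \matrix_(k, l) (v l (e k) / v l 0).
have -> : M = M' *m diag_mx (\row_l v l 0).
  apply/matrixP => k l; rewrite mul_mx_diag !mxE divfK //.
rewrite det_mulmx -(det_tr M') (determinant_alternate ij) ?mul0r // => k.
by rewrite !mxE same.
Qed.

(** Row orthogonality says that the square matrix of the characters has its
    conjugate transpose, over [#|X|], as right inverse.  This is then also a left
    inverse, which is the column orthogonality needed for Parseval. *)
Lemma character_duality : exists (n : nat) (chi : 'I_n.+1 -> X -> C),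
  (forall i, is_character (chi i)) /\
  forall x y, \sum_i chi i x * conjc (chi i y) = #|X|%:R * (x == y)%:R.
Proof.
have [n [e [chi [[r eK rK] chiP distinct]]]] := character_basis.
case: n e chi r eK rK chiP distinct => [|n] e chi r eK rK chiP distinct.
  by case: (r 0).
have X0 : #|X|%:R != 0 :> C by rewrite pnatr_eq0 -lt0n; apply/card_gt0P; exists 0.
exists n, chi; split=> // x y.
pose Q := \matrix_(i < n.+1, j < n.+1) chi i (e j).
pose Q' := \matrix_(j < n.+1, i < n.+1) (#|X|%:R^-1 * conjc (chi i (e j))).
have QQ' : Q *m Q' = 1%:M.
  apply/matrixP => i j; rewrite !mxE.
  transitivity (\E_(x in X) (chi i x * conjc (chi j x))).
    rewrite /expect mulr_sumr [RHS](reindex e) /=; last by exists r => z _.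
    by apply: eq_bigr => k _; rewrite !mxE mulrCA.
  case: (eqVneq i j) => [->|ij].
    rewrite -[RHS](expect_cst (0 : X)); apply: eq_expect => z.
    by have /is_characterP[_ c1] := chiP j; rewrite -sqr_normc c1 expr1n.
  have [g /eqP gP] := distinct i j ij.
  have cij := characterM (chiP i) (characterC (chiP j)).
  apply: (expect_character (g := g) cij); apply/eqP => E; apply: gP.
  have /is_characterP[_ /(_ g) c1] := chiP j.
  have jj : chi j g * conjc (chi j g) = 1 by rewrite -sqr_normc c1 expr1n.
  by rewrite -[chi i g]mulr1 -jj mulrCA E mulr1.
have /matrixP/(_ (r y) (r x)) := mulmx1C QQ'.
rewrite !mxE (can_eq rK) => E; rewrite eq_sym -E mulr_sumr.
by apply: eq_bigr => i _; rewrite !mxE !rK mulrA mulrA mulfV // mul1r mulrC.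
Qed.

Lemma expect_conj (S : finType) (f : S -> C) :
  conjc (\E_(x in S) f x) = \E_(x in S) conjc (f x).
Proof. by rewrite /expect rmorphM fmorphV rmorph_nat rmorph_sum. Qed.

Lemma sqr_norm_expect (S : finType) (f : S -> C) :
  `|\E_(x in S) f x| ^+ 2 = \E_(x in S) \E_(y in S) (f x * conjc (f y)).
Proof.
rewrite sqr_normc expect_conj -expectMr; apply: eq_expect => x.
by rewrite -expectMl.
Qed.

Lemma parseval (n : nat) (chi : 'I_n -> X -> C) (f : X -> C) :
  (forall x y, \sum_i chi i x * conjc (chi i y) = #|X|%:R * (x == y)%:R) ->
  \sum_i `|\E_(x in X) (f x * chi i x)| ^+ 2 = \E_(x in X) `|f x| ^+ 2.
Proof.
move=> dual.
have X0 : #|X|%:R != 0 :> C by rewrite pnatr_eq0 -lt0n; apply/card_gt0P; exists 0.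
under eq_bigr do rewrite sqr_norm_expect /expect.
rewrite -mulr_sumr exchange_big /= /expect; congr (_ * _); apply: eq_bigr => x _.
rewrite -mulr_sumr exchange_big /=.
transitivity (#|X|%:R^-1 * \sum_y (f x * conjc (f y) * (#|X|%:R * (x == y)%:R))).
  congr (_ * _); apply: eq_bigr => y _; rewrite -dual mulr_sumr.
  by apply: eq_bigr => i _; rewrite rmorphM mulrACA.
rewrite (bigD1 x) //= eqxx mulr1 big1 ?addr0; last first.
  by move=> y; rewrite eq_sym => /negPf ->; rewrite !mulr0.
by rewrite sqr_normc mulrC mulfK.
Qed.

(** The Fourier coefficients of the autocorrelation
    [k |-> E_x g(x + k) conj(g x)] are the [|c i|^2], where [c i] are those of
    [g].  By Parseval, the left-hand side is [sum_i |c i|^4], at most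
    [max_i |c i|^2 * sum_i |c i|^2], and the last sum is [E |g|^2 <= 1]. *)
Lemma U2_inverse (g : X -> C) : (forall x, `|g x| <= 1) ->
  exists2 chi : X -> C, is_character chi &
    \E_(k in X) `|\E_(x in X) mulderiv k g x| ^+ 2
      <= `|\E_(x in X) (g x * chi x)| ^+ 2.
Proof.
move=> g1; have [n [chi [chiP dual]]] := character_duality.
pose c i := \E_(x in X) (g x * chi i x).
pose i0 := [arg max_(i > ord0) Normc.normc (c i)]%O.
have i0P i : `|c i| <= `|c i0|.
  rewrite /i0; case: arg_maxP => // j _ /(_ i isT).
  by rewrite !norm_normc lecR.
exists (chi i0) => //.
rewrite -(parseval (chi := chi)) //.
have coef i : \E_(k in X) ((\E_(x in X) mulderiv k g x) * chi i k) = `|c i| ^+ 2.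
  under eq_expect do rewrite -expectMr.
  rewrite exchange_expect sqr_normc expect_conj -expectMl; apply: eq_expect => x.
  rewrite /c -[in RHS](expect_shift _ x) -expectMr; apply: eq_expect => k.
  have /is_characterP[cD c1] := chiP i.
  rewrite /mulderiv cD rmorphM addrC.
  have xx : chi i x * conjc (chi i x) = 1 by rewrite -sqr_normc c1 expr1n.
  rewrite -[LHS]mulr1 -xx; ring.
apply: le_trans (_ : \sum_i `|c i0| ^+ 2 * `|c i| ^+ 2 <= _).
  apply: ler_sum => i _; rewrite coef normrX normr_id expr2.
  by rewrite ler_wpM2r ?exprn_ge0 // lerXn2r ?nnegrE.
rewrite -mulr_sumr parseval //; apply: ler_piMr; first by rewrite exprn_ge0.
by apply: expect_le_cst => // x; rewrite exprn_ile1.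
Qed.

End Characters.

(** * Box products and the Gowers-Cauchy-Schwarz inequality *)

Section Box.
Variables (R : realType) (S : finType).
Local Notation C := R[i].
Implicit Types (w L : seq S -> C) (h k : seq S).

(** The alternating product over the vertices of a box: with [t = size h],
    [box w h h' = prod_(omega in {0,1}^t) C^|omega| (w h^omega)], where
    [h^omega] has its [i]-th entry taken in [h] if [omega_i = 0] and in [h']
    otherwise, and [C] is the complex conjugation. *)
Fixpoint box w h h' {struct h} : C :=
  match h, h' with
  | a :: k, a' :: k' => box (fun u => w (a :: u) * conjc (w (a' :: u))) k k'
  | _, _ => w [::]
  end.

(** The product of the factors of [box w h h'] other than the corner [w h]; see
    [boxE]. *)
Fixpoint boxrest w h h' {struct h} : C :=
  match h, h' with
  | a :: k, a' :: k' =>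
      conjc (box (fun u => w (a' :: u)) k k') * boxrest (fun u => w (a :: u)) k k'
  | _, _ => 1
  end.

Lemma eq_box w1 w2 h h' : w1 =1 w2 -> box w1 h h' = box w2 h h'.
Proof.
elim: h h' w1 w2 => [|a k IH] [|a' k'] w1 w2 w12 //=.
by apply: IH => u; rewrite !w12.
Qed.

Lemma boxM w1 w2 h h' :
  box (fun u => w1 u * w2 u) h h' = box w1 h h' * box w2 h h'.
Proof.
elim: h h' w1 w2 => [|a k IH] [|a' k'] w1 w2 //=.
by rewrite -IH; apply: eq_box => u; rewrite rmorphM mulrACA.
Qed.

Lemma boxC w h h' : box (fun u => conjc (w u)) h h' = conjc (box w h h').
Proof.
elim: h h' w => [|a k IH] [|a' k'] w //=.
by rewrite -IH; apply: eq_box => u; rewrite rmorphM.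
Qed.

Lemma box1 h h' : box (fun _ => 1) h h' = 1.
Proof.
elim: h h' => [|a k IH] [|a' k'] //.
rewrite -[RHS](IH k') -[LHS]/(box (fun=> 1 * conjc 1) k k').
by apply: eq_box => u; rewrite conjc1 mulr1.
Qed.

Lemma box_prod (I : Type) (r : seq I) (P : pred I) (w : I -> seq S -> C) h h' :
  box (fun u => \prod_(i <- r | P i) w i u) h h' =
  \prod_(i <- r | P i) box (w i) h h'.
Proof.
elim: r => [|i r IH].
  by rewrite big_nil -[RHS](box1 h h'); apply: eq_box => u; rewrite big_nil.
rewrite big_cons -IH; case: ifP => Pi; rewrite -?boxM; apply: eq_box => u;
by rewrite big_cons Pi.
Qed.

Lemma boxE w h h' : size h = size h' -> box w h h' = w h * boxrest w h h'.
Proof.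
elim: h h' w => [|a k IH] [|a' k'] w //=; first by rewrite mulr1.
by move=> [/IH E]; rewrite boxM boxC E mulrAC -mulrA.
Qed.

Lemma norm_box_le1 w h h' : (forall u, `|w u| <= 1) -> `|box w h h'| <= 1.
Proof.
elim: h h' w => [|a k IH] [|a' k'] w w1 //=.
by apply: IH => u; rewrite normrM normcJ mulr_ile1.
Qed.

Lemma norm_box1 w h h' : (forall u, `|w u| = 1) -> `|box w h h'| = 1.
Proof.
elim: h h' w => [|a k IH] [|a' k'] w w1 //=.
by apply: IH => u; rewrite normrM normcJ !w1 mulr1.
Qed.

Lemma norm_boxrest_le1 w h h' : (forall u, `|w u| <= 1) -> `|boxrest w h h'| <= 1.
Proof.
elim: h h' w => [|a k IH] [|a' k'] w w1 //=; rewrite ?normr1 //.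
by rewrite normrM normcJ mulr_ile1 ?norm_box_le1 ?IH.
Qed.

(** [L] is, on lists [h] of length [t], a product of [t] functions bounded by 1,
    the [i]-th of which does not depend on the [i]-th entry of [h]: [L1] is the
    factor that ignores the first entry, and for each value [a] of this entry
    [L'] collects the others. *)
Fixpoint lowdeg (t : nat) L : Prop :=
  if t is t'.+1 then
    exists2 L1 : seq S -> C, (forall h, `|L1 h| <= 1) &
      forall a, exists2 L' : seq S -> C, lowdeg t' L' &
        forall h, L (a :: h) = L1 h * L' h
  else L [::] = 1.

Lemma lowdegM t L1 L2 :
  lowdeg t L1 -> lowdeg t L2 -> lowdeg t (fun h => L1 h * L2 h).
Proof.
elim: t L1 L2 => [|t IH] L1 L2 /=; first by move=> -> ->; rewrite mulr1.
move=> [M1 M1b L1P] [M2 M2b L2P]; exists (fun h => M1 h * M2 h) => [h|a].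
  by rewrite normrM mulr_ile1.
have [L1' low1 E1] := L1P a; have [L2' low2 E2] := L2P a.
exists (fun h => L1' h * L2' h); first exact: IH.
by move=> h; rewrite E1 E2 mulrACA.
Qed.

Lemma lowdegC t L : lowdeg t L -> lowdeg t (fun h => conjc (L h)).
Proof.
elim: t L => [|t IH] L /=; first by move=> ->; rewrite conjc1.
move=> [M Mb LP]; exists (fun h => conjc (M h)) => [h|a]; first by rewrite normcJ.
have [L' low E] := LP a.
by exists (fun h => conjc (L' h)) => [|h]; [exact: IH|rewrite E rmorphM].
Qed.

(** For fixed [h'], every vertex of the box other than [h] takes some entry from
    [h'], and the corresponding factor ignores that entry of [h]. *)
Lemma lowdeg_boxrest w h' : (forall u, `|w u| <= 1) ->
  lowdeg (size h') (fun h => boxrest w h h').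
Proof.
elim: h' w => [|a' k' IH] w w1 //=.
exists (fun h => conjc (box (fun u => w (a' :: u)) h k')) => [h|a].
  by rewrite normcJ norm_box_le1.
by exists (fun h => boxrest (fun u => w (a :: u)) h k') => [|h //]; apply: IH.
Qed.

Lemma expect_boxS t w :
  \E_(h in t.+1.-tuple S) \E_(h' in t.+1.-tuple S) box w h h' =
  \E_(a in S) \E_(a' in S) \E_(h in t.-tuple S) \E_(h' in t.-tuple S)
    box (fun u => w (a :: u) * conjc (w (a' :: u))) h h'.
Proof.
rewrite (expect_tupleS _ (fun h => \E_(h' in t.+1.-tuple S) box w h h')).
apply: eq_expect => a; rewrite [RHS]exchange_expect; apply: eq_expect => k.
by rewrite (expect_tupleS _ (fun h' => box w (a :: k) h')).
Qed.

(** Cauchy-Schwarz in all the variables but the first, which discards the factor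
    of [L] that ignores the first variable and doubles this variable. *)
Lemma box_step t w L : lowdeg t.+1 L ->
  exists2 L' : S -> seq S -> C, forall a, lowdeg t (L' a) &
   `|\E_(h in t.+1.-tuple S) (w h * L h)| ^+ 2 <=
   \E_(a in S) \E_(a' in S) \E_(h in t.-tuple S)
     (w (a :: h) * conjc (w (a' :: h)) * (L' a h * conjc (L' a' h))).
Proof.
move=> [L1 L1b L1P].
have [L' L'P] : {L' : S -> seq S -> C &
    forall a, lowdeg t (L' a) /\ forall h, L (a :: h) = L1 h * L' a h}.
  apply: (@choice _ _ (fun a M => lowdeg t M /\ forall h, L (a :: h) = L1 h * M h)) => a.
  by have [L' low E] := L1P a; exists L'.
exists L' => [a|]; first by have [] := L'P a.
rewrite (expect_tupleS _ (fun h => w h * L h)) exchange_expect.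
apply: le_trans (_ : (\E_(h in t.-tuple S)
   `|\E_(a in S) (w (a :: h) * L' a h)|) ^+ 2 <= _).
  rewrite lerXn2r ?nnegrE ?expect_ge0 //; apply: le_trans (norm_expect _) _.
  apply: le_expect => h.
  rewrite (eq_expect (g := fun a => L1 h * (w (a :: h) * L' a h))); last first.
    by move=> a; have [_ ->] := L'P a; rewrite mulrCA.
  by rewrite expectMl normrM ler_piMl.
apply: le_trans (jensen_sqr _) _ => [h //|].
rewrite le_eqVlt; apply/orP; left; apply/eqP.
transitivity (\E_(h in t.-tuple S) \E_(a in S) \E_(a' in S)
     (w (a :: h) * conjc (w (a' :: h)) * (L' a h * conjc (L' a' h)))).
  apply: eq_expect => h; rewrite sqr_norm_expect; apply: eq_expect => a.
  by apply: eq_expect => a'; rewrite rmorphM mulrACA.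
rewrite exchange_expect; apply: eq_expect => a; exact: exchange_expect.
Qed.

(** Positivity of the right-hand side, which lets the powers be taken out of the
    averages, fails when no variable is doubled: hence [t.+1]. *)
Lemma box_CS_pointwise t w L : lowdeg t.+1 L ->
  `|\E_(h in t.+1.-tuple S) (w h * L h)| ^+ (2 ^ t.+1) <=
  \E_(h in t.+1.-tuple S) \E_(h' in t.+1.-tuple S) box w h h'.
Proof.
elim: t w L => [|t IH] w L Llow.
  have [L' low' le'] := box_step w Llow.
  rewrite expn1 expect_boxS; apply: (le_trans le').
  apply: le_expect => a; apply: le_expect => a'.
  rewrite (expect_tuple0 (fun h => w (a :: h) * conjc (w (a' :: h)) * (L' a h * conjc (L' a' h)))).
  rewrite (expect_tuple0 (fun h => \E_(h' in 0.-tuple S) box (fun u => w (a :: u) * conjc (w (a' :: u))) h h')).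
  rewrite (expect_tuple0 (fun h' => box (fun u => w (a :: u) * conjc (w (a' :: u))) [::] h')).
  by have /= -> := low' a; have /= -> := low' a'; rewrite conjc1 !mulr1.
have [L' low' le'] := box_step w Llow.
rewrite expnS exprM expect_boxS.
set I := (X in _ <= X) in le'; have I0 : 0 <= I by apply: le_trans le'; rewrite exprn_ge0.
apply: le_trans (_ : I ^+ (2 ^ t.+1) <= _).
  by rewrite lerXn2r ?nnegrE ?exprn_ge0.
rewrite -(ger0_norm I0); apply: le_trans (jensen_norm _ _) _.
apply: le_expect => a; apply: le_trans (jensen_norm _ _) _.
apply: le_expect => a'.
apply: (IH (fun h => w (a :: h) * conjc (w (a' :: h))) (fun h => L' a h * conjc (L' a' h))).
by apply: lowdegM => //; apply: lowdegC.
Qed.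

(** Gowers-Cauchy-Schwarz: the factors of low degree can be removed, at the cost
    of replacing [w] by its alternating products over boxes.  For [t = 0] both
    sides are equal, thanks to the absolute value outside the mean over [z]. *)
Lemma box_CS (Z : finType) t (w L : Z -> seq S -> C) : (forall z, lowdeg t (L z)) ->
  `|\E_(z in Z) \E_(h in t.-tuple S) (w z h * L z h)| ^+ (2 ^ t) <=
  `|\E_(z in Z) \E_(h in t.-tuple S) \E_(h' in t.-tuple S) box (w z) h h'|.
Proof.
case: t => [|t] Llow.
  rewrite expr1 le_eqVlt; apply/orP; left; apply/eqP; congr (`|_|).
  apply: eq_expect => z.
  rewrite (expect_tuple0 (fun h => w z h * L z h)).
  rewrite (expect_tuple0 (fun h => \E_(h' in 0.-tuple S) box (w z) h h')).
  rewrite (expect_tuple0 (fun h' => box (w z) [::] h')).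
  by have /= -> := Llow z; rewrite mulr1.
apply: le_trans (jensen_norm _ _) _.
rewrite ger0_norm; last first.
  apply: expect_ge0 => z; apply: le_trans (box_CS_pointwise (w z) (Llow z)).
  by rewrite exprn_ge0.
by apply: le_expect => z; apply: box_CS_pointwise.
Qed.

End Box.

Section Gowers.
Variables (R : realType) (X : finZmodType).
Local Notation C := R[i].
Implicit Types (F : X -> C) (h : seq X).

(** With [h] as variable, [box (pullsum F x)] is a product over the vertices of a
    parallelepiped; [mulderivs_box] shows multiplicative derivatives to be of this
    form. *)
Definition pullsum F (x : X) (h : seq X) : C := F (x + \sum_(b <- h) b).

Lemma eq_mulderivs F1 F2 h : F1 =1 F2 -> mulderivs h F1 =1 mulderivs h F2.
Proof.
move=> F12; elim: h => [//|a h IH] x /=.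
by rewrite /mulderiv !IH.
Qed.

Lemma mulderivs_box F h x :
  mulderivs h F x = box (pullsum F x) h (nseq (size h) 0).
Proof.
elim: h F x => [|a h IH] F x /=; first by rewrite /pullsum big_nil addr0.
rewrite /mulderiv !IH -boxC -boxM; apply: eq_box => u.
by rewrite /pullsum !big_cons add0r addrA.
Qed.

Lemma mulderivs_comm F a h x :
  mulderivs h (mulderiv a F) x = mulderiv a (mulderivs h F) x.
Proof.
elim: h x => [//|b h IH] x /=.
rewrite {1}/mulderiv !IH /mulderiv !rmorphM /= -!addrA [a + b]addrC.
by rewrite !mulrA [_ * _ * conjc (mulderivs h F (x + a))]mulrAC.
Qed.

Lemma mulderivs_shift F a h x :
  mulderivs h (fun z => F (z + a)) x = mulderivs h F (x + a).
Proof.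
elim: h x => [//|b h IH] x /=.
by rewrite /mulderiv !IH addrAC.
Qed.

Lemma gowers_avg_rec t F :
  gowers_avg t.+1 F = \E_(b in X) gowers_avg t (mulderiv b F).
Proof.
rewrite /gowers_avg (expect_tupleS _ (fun h => \E_(x in X) mulderivs h F x)).
apply: eq_expect => b; apply: eq_expect => h; apply: eq_expect => x.
by rewrite mulderivs_comm.
Qed.

(** Doubling the variable [a] into [a] and [a'] gives, after translation by
    [a'], the multiplicative derivative of step [a - a'], and this difference is
    uniformly distributed. *)
Lemma gowers_avg_box t F :
  \E_(x in X) \E_(h in t.-tuple X) \E_(h' in t.-tuple X) box (pullsum F x) h h' =
  gowers_avg t F.
Proof.
elim: t F => [|t IH] F.
  rewrite /gowers_avg (expect_tuple0 (fun h => \E_(x in X) mulderivs h F x)).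
  apply: eq_expect => x.
  rewrite (expect_tuple0 (fun h => \E_(h' in 0.-tuple X) box (pullsum F x) h h')).
  rewrite (expect_tuple0 (fun h' => box (pullsum F x) [::] h')).
  by rewrite /= /pullsum big_nil addr0.
transitivity (\E_(a in X) \E_(a' in X)
    gowers_avg t (fun z => F (z + a) * conjc (F (z + a')))).
  rewrite (eq_expect (fun x => expect_boxS t (pullsum F x))) exchange_expect.
  apply: eq_expect => a; rewrite exchange_expect; apply: eq_expect => a'.
  rewrite -IH; apply: eq_expect => x; apply: eq_expect => h; apply: eq_expect => h'.
  apply: eq_box => u; rewrite /pullsum !big_cons.
  by rewrite !addrA [x + a + _]addrAC [x + a' + _]addrAC.
rewrite exchange_expect -[LHS]/(\E_(a' in X) _) -[RHS](expect_cst (0 : X)).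
apply: eq_expect => a'; rewrite gowers_avg_rec.
rewrite -[LHS](expect_shift _ a'); apply: eq_expect => b.
apply: eq_expect => h; rewrite -[RHS](expect_shift _ a'); apply: eq_expect => x.
rewrite -mulderivs_shift; apply: eq_mulderivs => z.
by rewrite /mulderiv -addrA [a' + b]addrC.
Qed.

End Gowers.

(** * Degree lowering for averages of functions *)

Section DegreeLowering.
Variables (R : realType) (X : finZmodType).
Local Notation C := R[i].

Lemma norm_mulderivs_le1 (F : X -> C) (h : seq X) x :
  (forall z, `|F z| <= 1) -> `|mulderivs h F x| <= 1.
Proof. by move=> F1; rewrite mulderivs_box norm_box_le1 // => u; apply: F1. Qed.

Lemma mulderivs_pullsum (F : X -> C) (h : seq X) x :
  mulderivs h F x = pullsum F x h * boxrest (pullsum F x) h (nseq (size h) 0).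
Proof. by rewrite mulderivs_box boxE ?size_nseq. Qed.

Lemma mulderivM (F1 F2 : X -> C) k x :
  mulderiv k (fun z => F1 z * F2 z) x = mulderiv k F1 x * mulderiv k F2 x.
Proof. by rewrite /mulderiv rmorphM mulrACA. Qed.

Lemma gowers_avgSS t (F : X -> C) :
  gowers_avg t.+2 F =
  \E_(h in t.-tuple X) \E_(k in X) `|\E_(x in X) mulderiv k (mulderivs h F) x| ^+ 2.
Proof.
rewrite gowers_avgS (expect_tupleS _ (fun h => `|\E_(x in X) mulderivs h F x| ^+ 2)).
exact: exchange_expect.
Qed.

(** For fixed [h'], the phase is of low degree in [h], so that [box_CS] removes
    it from the average of the derivatives of [F].  The square introduces one more
    derivative, whence the [U^{t+1}] norm. *)
Lemma twisted_gowers_le t (F : X -> C) (psi : seq X -> X -> C) (h' : seq X) :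
  size h' = t -> (forall x, `|F x| <= 1) -> (forall h x, `|psi h x| = 1) ->
  (\E_(h in t.-tuple X)
     `|\E_(x in X) (mulderivs h F x * conjc (boxrest (psi^~ x) h h'))| ^+ 2)
     ^+ (2 ^ t) <= gowers_avg t.+1 F.
Proof.
move=> sz F1 psi1.
pose w (z : X * X) := pullsum (mulderiv z.2 F) z.1.
pose L (z : X * X) h := boxrest (w z) h (nseq t 0) *
  (conjc (boxrest (psi^~ (z.1 + z.2)) h h') * boxrest (psi^~ z.1) h h').
have w1 z u : `|w z u| <= 1.
  by rewrite /w /pullsum /mulderiv normrM normcJ mulr_ile1.
have Llow z : lowdeg t (L z).
  apply: lowdegM; first by rewrite -{1}(size_nseq t (0 : X)); apply: lowdeg_boxrest.
  by apply: lowdegM; [apply: lowdegC|]; rewrite -sz; apply: lowdeg_boxrest => u; rewrite psi1.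
have EE : \E_(h in t.-tuple X)
     `|\E_(x in X) (mulderivs h F x * conjc (boxrest (psi^~ x) h h'))| ^+ 2 =
   \E_(z in (X * X)%type) \E_(h in t.-tuple X) (w z h * L z h).
  rewrite [RHS]exchange_expect; apply: eq_expect => h.
  rewrite -expect_mulderiv exchange_expect expect_pair.
  apply: eq_expect => x; apply: eq_expect => k.
  rewrite mulderivM -mulderivs_comm mulderivs_pullsum size_tuple /w /L /= -mulrA.
  by rewrite [mulderiv k (fun _ => conjc _) x]/mulderiv conjcK.
have E0 : 0 <= \E_(h in t.-tuple X)
     `|\E_(x in X) (mulderivs h F x * conjc (boxrest (psi^~ x) h h'))| ^+ 2.
  by apply: expect_ge0 => h; rewrite exprn_ge0.
rewrite -(ger0_norm E0) EE; apply: le_trans (box_CS w Llow) _.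
rewrite expect_pair exchange_expect /w /=.
rewrite (eq_expect (fun k => gowers_avg_box t (mulderiv k F))) -gowers_avg_rec.
by rewrite ger0_norm // gowers_avg_ge0.
Qed.

(** The [U^{t+2}] norm is controlled by the [U^{t+1}] norm when the alternating
    products of the [G y] over boxes do not correlate with nontrivial characters.
    The quantity [Q] is the mean over [h] and [h'] of the correlation of
    [Delta_h D] with the part of low degree of the phase [phi] of [h] and [h']. *)
Lemma degree_lowering_step (Y : finType) (t : nat) (G : Y -> X -> C) (eps : C) :
  0 <= eps -> (forall y x, `|G y x| <= 1) ->
  (forall phi : X -> C, is_character phi -> (exists x, phi x != 1) ->
   forall h h' : t.-tuple X,
     `|\E_(x in X) \E_(y in Y) (phi x * box (pullsum (G y) x) h h')| <= eps) ->
  exists2 Q : C, 0 <= Q &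
    gowers_avg t.+2 (fun x => \E_(y in Y) G y x) ^+ (2 ^ t) <= Q + eps /\
    Q ^+ (2 ^ t.+1) <= gowers_avg t.+1 (fun x => \E_(y in Y) G y x).
Proof.
move=> eps0 G1 equi; pose D x := \E_(y in Y) G y x; rewrite -/D.
have D1 x : `|D x| <= 1 by apply: norm_expect_le => // y.
have [chi chiP] : {chi : seq X -> X -> C & forall h, is_character (chi h) /\
    \E_(k in X) `|\E_(x in X) mulderiv k (mulderivs h D) x| ^+ 2
      <= `|\E_(x in X) (mulderivs h D x * chi h x)| ^+ 2}.
  apply: (@choice _ _ (fun h psi => is_character psi /\
     \E_(k in X) `|\E_(x in X) mulderiv k (mulderivs h D) x| ^+ 2
       <= `|\E_(x in X) (mulderivs h D x * psi x)| ^+ 2)) => h.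
  by have [|psi psiP le'] := @U2_inverse _ _ (mulderivs h D);
    [by move=> x; apply: norm_mulderivs_le1|exists psi].
have chi1 h x : `|chi h x| = 1.
  by have [/is_characterP[_ ->]] := chiP h.
(* The phase of the correlation is absorbed in a factor [b h] that, being constant
   in [x], does not interfere with the characters. *)
pose b h := conjc (\E_(x in X) (mulderivs h D x * chi h x)).
have b1 h : `|b h| <= 1.
  rewrite normcJ; apply: norm_expect_le => // x.
  by rewrite normrM chi1 mulr1 norm_mulderivs_le1.
pose w (z : X * Y) h := b h * chi h z.1 * pullsum (G z.2) z.1 h.
pose L (z : X * Y) h := boxrest (pullsum D z.1) h (nseq t 0).
have Llow z : lowdeg t (L z).
  rewrite -{1}(size_nseq t (0 : X)); apply: lowdeg_boxrest => u; exact: D1.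
pose q h h' := `|\E_(x in X) (mulderivs h D x * conjc (boxrest (chi^~ x) h h'))|.
have q0 h h' : 0 <= q h h' by exact: normr_ge0.
have M0 : 0 <= gowers_avg t.+2 D by apply: gowers_avg_ge0.
have Mle : gowers_avg t.+2 D <=
    `|\E_(z in (X * Y)%type) \E_(h in t.-tuple X) (w z h * L z h)|.
  rewrite gowers_avgSS.
  rewrite (_ : \E_(z in (X * Y)%type) _ =
     \E_(h in t.-tuple X) `|\E_(x in X) (mulderivs h D x * chi h x)| ^+ 2).
    rewrite ger0_norm; first by apply: le_expect => h; have [] := chiP h.
    by apply: expect_ge0 => h; rewrite exprn_ge0.
  rewrite exchange_expect; apply: eq_expect => h.
  rewrite expect_pair sqr_normc mulrC -expectMl; apply: eq_expect => x.
  rewrite mulderivs_pullsum size_tuple /w /L /= {2}/pullsum {1}/D.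
  rewrite -!expectMr -expectMl; apply: eq_expect => y.
  rewrite /b /pullsum; ring.
exists (\E_(h' in t.-tuple X) \E_(h in t.-tuple X) q h h').
  by apply: expect_ge0 => h'; apply: expect_ge0 => h.
split; last first.
  rewrite expnS exprM.
  apply: le_trans (_ : (\E_(h' in t.-tuple X) \E_(h in t.-tuple X) q h h' ^+ 2)
                         ^+ (2 ^ t) <= _).
    rewrite lerXn2r ?nnegrE ?exprn_ge0 ?expect_ge0 //.
    - by move=> h'; apply: expect_ge0 => h.
    - by move=> h'; apply: expect_ge0 => h; rewrite exprn_ge0.
    apply: le_trans (jensen_sqr _) _ => [h'|]; first by apply: expect_ge0 => h.
    by apply: le_expect => h'; apply: jensen_sqr => h.
  apply: le_trans (jensen _ _) _ => [h'|].
    by apply: expect_ge0 => h; rewrite exprn_ge0.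
  apply: expect_le_cst => [|h']; first exact: gowers_avg_ge0.
  by apply: twisted_gowers_le => //; rewrite size_tuple.
apply: le_trans (_ : `|\E_(z in (X * Y)%type) \E_(h in t.-tuple X)
                         (w z h * L z h)| ^+ (2 ^ t) <= _).
  by rewrite lerXn2r ?nnegrE.
apply: le_trans (box_CS w Llow) _.
rewrite exchange_expect (eq_expect (fun h => exchange_expect _)) exchange_expect.
apply: le_trans (norm_expect _) _.
rewrite -[X in _ + X](@expect_cst _ _ [tuple of nseq t (0 : X)]) -expectD.
apply: le_expect => h'; apply: le_trans (norm_expect _) _.
rewrite -[X in _ + X](@expect_cst _ _ [tuple of nseq t (0 : X)]) -expectD.
apply: le_expect => h.
(* If [phi] is trivial, [chi h] is the conjugate of the part of low degree, and
   the bound comes from [|b h|]; otherwise it comes from the hypothesis. *)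
pose phi x := box (chi^~ x) h h'.
have -> : \E_(z in (X * Y)%type) box (w z) h h' =
    box b h h' * \E_(x in X) \E_(y in Y) (phi x * box (pullsum (G y) x) h h').
  rewrite expect_pair -expectMl; apply: eq_expect => x.
  rewrite -expectMl; apply: eq_expect => y.
  by rewrite /w /= (boxM (fun u => b u * chi u x)) (boxM b) mulrA.
have phiC : is_character phi.
  apply/is_characterP; split=> [x y|x]; last exact: norm_box1.
  rewrite /phi -boxM; apply: eq_box => u.
  by have [/is_characterP[-> _] _] := chiP u.
have szh : size h = size h' by rewrite !size_tuple.
have EG1 : `|\E_(x in X) \E_(y in Y) (phi x * box (pullsum (G y) x) h h')| <= 1.
  apply: norm_expect_le => // x; apply: norm_expect_le => // y.
  rewrite normrM mulr_ile1 ?norm_box_le1 // => u; [by rewrite chi1|exact: G1].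
rewrite normrM; case: (boolP [forall x, phi x == 1]) => [/forallP phi1|].
  apply: ler_wpDr => //; apply: le_trans (_ : `|box b h h'| <= _); first exact: ler_piMr.
  rewrite boxE // normrM; apply: le_trans (_ : `|b h| <= _).
    by apply: ler_piMr => //; apply: norm_boxrest_le1.
  rewrite normcJ le_eqVlt; apply/orP; left; apply/eqP; congr (`|_|).
  apply: eq_expect => x; congr (_ * _).
  have /eqP := phi1 x; rewrite /phi boxE // => E.
  have cc : chi h x * conjc (chi h x) = 1 by rewrite -sqr_normc chi1 expr1n.
  have nz : chi h x != 0 by rewrite -normr_eq0 chi1 oner_eq0.
  by rewrite -[LHS]conjcK; congr conjc; apply: (mulfI nz); rewrite cc E.
rewrite negb_forall => /existsP phi1.
apply: ler_wpDl; first exact: normr_ge0.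
apply: le_trans (_ : 1 * eps <= _); last by rewrite mul1r.
by apply: ler_pM => //; [exact: norm_box_le1|exact: equi].
Qed.

End DegreeLowering.

(** * Iterated degree lowering *)

Section PowerBounds.
Variable R : realType.
Implicit Types (x K d c : R).

Lemma powR_le1_anti d c c' : 0 <= d <= 1 -> 0 < c -> c <= c' -> d `^ c' <= d `^ c.
Proof.
move=> /andP[d0 d1] c0 cc'; move: d0; rewrite le_eqVlt => /orP[/eqP <-|d0].
  by rewrite !powR0 // gt_eqF // (lt_le_trans c0).
by apply: ger_powR => //; rewrite d0.
Qed.

(** As [K >= 1], the root of [K] can be bounded by [K] itself. *)
Lemma powR_bound x K d c r : 0 <= x -> 1 <= K -> 0 <= d -> 0 < r <= 1 ->
  x <= K * d `^ c -> x `^ r <= K * d `^ (c * r).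
Proof.
move=> x0 K1 d0 /andP[r0 r1] le.
have K0 : 0 <= K by apply: le_trans K1.
apply: le_trans (_ : (K * d `^ c) `^ r <= _).
  apply: ge0_ler_powR => //; first exact: ltW.
  by rewrite nnegrE mulr_ge0 ?powR_ge0.
rewrite powRM ?powR_ge0 // powRrM; apply: ler_wpM2r; first exact: powR_ge0.
exact: ler1_powR.
Qed.

Lemma root_bound x K d c n : (0 < n)%N -> 0 <= x -> 1 <= K -> 0 <= d ->
  x ^+ n <= K * d `^ c -> x <= K * d `^ (c * n%:R^-1).
Proof.
move=> n0 x0 K1 d0 le.
have -> : x = (x ^+ n) `^ n%:R^-1.
  by rewrite -powR_mulrn // -powRrM mulfV ?powRr1 // pnatr_eq0 -lt0n.
apply: powR_bound => //; first exact: exprn_ge0.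
by rewrite invr_gt0 ltr0n n0 invf_le1 ?ltr0n // ler1n.
Qed.

End PowerBounds.

Section Complex.
Variable R : realType.
Local Notation C := R[i].

Lemma ge0_Re (z : C) : 0 <= z -> z = (complex.Re z)%:C.
Proof. by move=> z0; rewrite RRe_real // ger0_real. Qed.

Lemma Re_ge0 (z : C) : 0 <= z -> 0 <= complex.Re z.
Proof. by rewrite lecE => /andP[]. Qed.

End Complex.

(** Iteration of [degree_lowering_step] from the [U^1] norm, which is zero, up to
    the [U^{s+1}] norm. *)
Lemma degree_lowering (R : realType) (s : nat) (K c : R) : 0 < K -> 0 < c ->
  exists K' c' : R, [/\ 1 <= K', 0 < c' &
  forall (X : finZmodType) (Y : finType) (G : Y -> X -> R[i]) (d : R),
  0 <= d <= 1 -> (forall y x, `|G y x| <= 1) ->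
  (forall phi : X -> R[i], is_character phi -> (exists x, phi x != 1) ->
   forall h h' : seq X, size h = size h' ->
     `|\E_(x in X) \E_(y in Y) (phi x * box (pullsum (G y) x) h h')|
       <= (K * d `^ c)%:C) ->
  \E_(x in X) \E_(y in Y) G y x = 0 ->
  complex.Re (gowers_avg s.+1 (fun x => \E_(y in Y) G y x)) <= K' * d `^ c'].
Proof.
move=> K0 c0; elim: s => [|s [K1 [c1 [K1ge c1gt IH]]]].
  exists 1, 1; split=> // X Y G d d01 G1 equi E0.
  rewrite gowers_avgS (expect_tuple0 (fun h => `|\E_(x in X) mulderivs h _ x| ^+ 2)).
  by rewrite [\E_(x in X) _]E0 normr0 expr0n /= mul1r powR_ge0.
(* [Q] is at most the [2 ^ s.+1]-th root of the quantity bounded by induction, and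
   the quantity to be bounded at most the [2 ^ s]-th root of [Q + K * d `^ c]. *)
pose c2 := Num.min (c1 * (2 ^ s.+1)%:R^-1) c.
have c2gt : 0 < c2 by rewrite lt_min c0 mulr_gt0 // invr_gt0 ltr0n expn_gt0.
exists (K1 + K), (c2 * (2 ^ s)%:R^-1).
have K1K : 1 <= K1 + K by rewrite (le_trans K1ge) // lerDl ltW.
split=> //; first by rewrite mulr_gt0 // invr_gt0 ltr0n expn_gt0.
move=> X Y G d d01 G1 equi E0; have /andP[d0 d1] := d01.
have eps0 : 0 <= (K * d `^ c)%:C :> R[i].
  by rewrite -[0]/(0%:C) lecR mulr_ge0 ?powR_ge0 // ltW.
have equi_s (phi : X -> R[i]) : is_character phi -> (exists x, phi x != 1) ->
    forall h h' : s.-tuple X,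
    `|\E_(x in X) \E_(y in Y) (phi x * box (pullsum (G y) x) h h')| <= (K * d `^ c)%:C.
  by move=> phiC phi1 h h'; apply: equi; rewrite ?size_tuple.
have [Q Q0 [uQ Qv]] := degree_lowering_step eps0 G1 equi_s.
have := IH X Y G d d01 G1 equi E0; move: uQ Qv.
have := @gowers_avg_ge0 _ X s.+2 (fun x => \E_(y in Y) G y x) isT.
have := @gowers_avg_ge0 _ X s.+1 (fun x => \E_(y in Y) G y x) isT.
move: (gowers_avg s.+1 _) (gowers_avg s.+2 _) => v u v0 u0.
rewrite (ge0_Re v0) (ge0_Re u0) (ge0_Re Q0) -!rmorphXn -rmorphD !lecR /=.
have Rq0 : 0 <= complex.Re Q by exact: Re_ge0.
have Ru0 : 0 <= complex.Re u by exact: Re_ge0.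
move: (complex.Re Q) (complex.Re u) (complex.Re v) Rq0 Ru0 => q u' v' q0 u'0 uq qv vle.
have qle : q <= K1 * d `^ (c1 * (2 ^ s.+1)%:R^-1).
  by apply: root_bound (le_trans qv vle) => //; rewrite expn_gt0.
apply: root_bound => //; first by rewrite expn_gt0.
apply: (le_trans uq); rewrite mulrDl; apply: lerD.
  apply: (le_trans qle); apply: ler_wpM2l; first exact: le_trans K1ge.
  by apply: powR_le1_anti => //; rewrite ge_min lexx.
apply: ler_wpM2l; first exact: ltW.
by apply: powR_le1_anti => //; rewrite ge_min lexx orbT.
Qed.

(** * The [L^2] norm *)

Section L2.
Variables (R : realType) (S : finType).
Local Notation C := R[i].
Implicit Types f g : S -> C.

Lemma L2norm_ge0 f : 0 <= L2norm f.
Proof. exact: sqrtr_ge0. Qed.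

Lemma L2norm_sqr f : ((L2norm f) ^+ 2)%:C = \E_(x in S) `|f x| ^+ 2.
Proof.
rewrite sqr_sqrtr; last by apply: expect_ge0 => x; rewrite sqr_ge0.
rewrite /expect rmorphM fmorphV rmorph_nat rmorph_sum /=; congr (_ * _).
by apply: eq_bigr => x _; rewrite norm_normc rmorphXn.
Qed.

Lemma eq_L2norm f g : f =1 g -> L2norm f = L2norm g.
Proof.
move=> fg; congr Num.sqrt; apply: eq_expect => x; by rewrite fg.
Qed.

Lemma L2norm_le f (B : R) :
  0 <= B -> \E_(x in S) `|f x| ^+ 2 <= (B ^+ 2)%:C -> L2norm f <= B.
Proof.
by move=> B0; rewrite -L2norm_sqr lecR ler_sqr // nnegrE ?L2norm_ge0.
Qed.

Lemma norm_expect_le_L2norm f g : (forall x, `|g x| <= 1) ->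
  `|\E_(x in S) (g x * f x)| <= (L2norm f)%:C.
Proof.
move=> g1.
have L0 : 0 <= (L2norm f)%:C by rewrite -[0]/(0%:C) lecR L2norm_ge0.
rewrite -ler_sqr ?nnegrE // [X in _ <= X](_ : _ = ((L2norm f) ^+ 2)%:C); last first.
  by rewrite rmorphXn.
rewrite L2norm_sqr.
apply: le_trans (jensen_norm 1 _) _.
apply: le_expect => x; rewrite expn1 normrM exprMn ler_piMl ?exprn_ge0 //.
by rewrite exprn_ile1.
Qed.

(** A form of the triangle inequality with worse constants, which come from
    [(a + b)^2 <= 2 a^2 + 2 b^2]. *)
Lemma L2norm_lin f g (mu : C) : `|mu| <= 1 ->
  L2norm (fun x => 2 * f x + mu * g x) <= 4 * L2norm f + 2 * L2norm g.
Proof.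
move=> mu1; have f0 := L2norm_ge0 f; have g0 := L2norm_ge0 g.
apply: L2norm_le; first by lra.
apply: le_trans (_ : (8 * L2norm f ^+ 2 + 2 * L2norm g ^+ 2)%:C <= _); last first.
  by rewrite lecR; nra.
have cast (a b : R) : (8 * a + 2 * b)%:C = 8 * a%:C + 2 * b%:C :> C.
  by rewrite rmorphD !rmorphM !rmorph_nat.
rewrite cast !L2norm_sqr -!expectMl -expectD; apply: le_expect => x.
have a0 := normr_ge0 (2 * f x); have b0 := normr_ge0 (mu * g x).
apply: le_trans (_ : (`|2 * f x| + `|mu * g x|) ^+ 2 <= _).
  by rewrite lerXn2r ?nnegrE ?addr_ge0 // ler_normD.
apply: le_trans (_ : 2 * `|2 * f x| ^+ 2 + 2 * `|mu * g x| ^+ 2 <= _).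
  rewrite -subr_ge0 [X in 0 <= X](_ : _ = (`|2 * f x| - `|mu * g x|) ^+ 2); last by ring.
  by rewrite real_exprn_even_ge0 // realB ?ger0_real.
apply: lerD.
  rewrite normrM exprMn ger0_norm // le_eqVlt; apply/orP; left; apply/eqP; ring.
apply: ler_wpM2l => //; rewrite normrM exprMn ler_piMl ?exprn_ge0 //.
by rewrite exprn_ile1.
Qed.

End L2.

(** * Averages along a shifted function and their dual functions *)

Lemma conjcM (R : realType) (x y : R[i]) : conjc (x * y) = conjc x * conjc y.
Proof. exact: rmorphM. Qed.

Lemma conjc_lin (R : realType) (z w : R[i]) : conjc (2 * z + w) = 2 * conjc z + conjc w.
Proof. by rewrite rmorphD rmorphM rmorph_nat. Qed.

Lemma disk_valuedE (R : realType) (S : Type) (f : S -> R[i]) :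
  disk_valued f <-> forall x, `|f x| <= 1.
Proof.
by split=> f1 x; have := f1 x; rewrite norm_normc -[1 : R[i]]/(1%:C) lecR.
Qed.

Lemma expect_bool (R : realType) (F : bool -> R[i]) :
  \E_(b in bool) F b = 2^-1 * (F true + F false).
Proof. by rewrite /expect card_bool big_bool. Qed.

Section Operator.
Variables (R : realType) (X : finZmodType) (Y : finType) (y0 : Y).
Local Notation C := R[i].
Variables (al : Y -> X) (P : X -> Y -> C) (k : Y -> C).
Hypotheses (P1 : forall x y, `|P x y| <= 1) (k1 : forall y, `|k y| <= 1).

Definition twisted_avg (g : X -> C) (x : X) : C :=
  \E_(y in Y) (P x y * g (x + al y) * k y).

(** The mean over [y] of these functions is the image of [T0] under the adjoint of
    [twisted_avg], by [twisted_avg_adjoint]. *)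
Definition dual_term (T0 : X -> C) (y : Y) (z : X) : C :=
  conjc (P (z - al y) y) * conjc (k y) * T0 (z - al y).

Lemma norm_twisted_avg g x : (forall z, `|g z| <= 1) -> `|twisted_avg g x| <= 1.
Proof.
move=> g1; apply: norm_expect_le => // y.
by rewrite !normrM !mulr_ile1 // mulr_ge0.
Qed.

Lemma norm_dual_term T0 y z : (forall x, `|T0 x| <= 1) -> `|dual_term T0 y z| <= 1.
Proof.
by move=> T1; rewrite !normrM !normcJ !mulr_ile1 // mulr_ge0.
Qed.

Lemma twisted_avg_adjoint T0 g :
  \E_(x in X) (twisted_avg g x * conjc (T0 x)) =
  \E_(z in X) (g z * conjc (\E_(y in Y) dual_term T0 y z)).
Proof.
rewrite (eq_expect (g := fun x =>
  \E_(y in Y) (P x y * g (x + al y) * k y * conjc (T0 x)))); last first.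
  by move=> x; rewrite expectMr.
rewrite [RHS](eq_expect (g := fun z =>
  \E_(y in Y) (g z * conjc (dual_term T0 y z)))); last first.
  by move=> z; rewrite expect_conj expectMl.
rewrite exchange_expect [RHS]exchange_expect; apply: eq_expect => y.
rewrite -[RHS](expect_shift _ (al y)); apply: eq_expect => x.
rewrite /dual_term addrK !(@conjcM R) !conjcK; ring.
Qed.

(** After the change of variable [z = x + al y], the box product of [T0] no longer
    involves [y], so that it can be bounded by 1 and only the average over [y] of
    the box products of [P] and [k] remains. *)
Lemma dual_equidistributed T0 phi (h h' : seq X) (eps : R) :
  (forall x, `|T0 x| <= 1) -> is_character phi ->
  L2norm (fun x => \E_(y in Y) (box (fun u => P (x + \sum_(b <- u) b) y) h h'
     * conjc (phi (al y)) * box (fun _ => k y) h h')) <= eps ->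
  `|\E_(x in X) \E_(y in Y) (phi x * box (pullsum (dual_term T0 y) x) h h')|
    <= eps%:C.
Proof.
move=> T1 /is_characterP[phiD phi1]; set F := (X in L2norm X) => le.
have -> : \E_(x in X) \E_(y in Y) (phi x * box (pullsum (dual_term T0 y) x) h h') =
    conjc (\E_(x in X) (conjc (phi x * box (pullsum T0 x) h h') * F x)).
  rewrite expect_conj exchange_expect.
  rewrite [RHS](eq_expect (g := fun x => \E_(y in Y) (phi x * box (pullsum T0 x) h h' *
    conjc (box (fun u => P (x + \sum_(b <- u) b) y) h h'
     * conjc (phi (al y)) * box (fun _ => k y) h h')))); last first.
    by move=> x; rewrite [LHS](@conjcM R) [X in X * _ = _](@conjcK R) /F expect_conj expectMl.
  rewrite [RHS]exchange_expect; apply: eq_expect => y.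
  rewrite -[LHS](expect_shift _ (al y)); apply: eq_expect => x.
  rewrite (@eq_box _ _ (pullsum (dual_term T0 y) (x + al y)) (fun u =>
    conjc (P (x + \sum_(b <- u) b) y) * conjc (k y) * pullsum T0 x u)).
    rewrite (boxM (fun u => conjc (P (x + \sum_(b <- u) b) y) * conjc (k y))).
    rewrite (boxM (fun u => conjc (P (x + \sum_(b <- u) b) y))).
    rewrite (boxC (fun u => P (x + \sum_(b <- u) b) y)) (boxC (fun _ => k y)).
    rewrite phiD !(@conjcM R) conjcK; ring.
  by move=> u; rewrite /pullsum /dual_term addrAC addrK.
rewrite normcJ; apply: le_trans (norm_expect_le_L2norm _ _) _; last by rewrite lecR.
by move=> x; rewrite normcJ normrM phi1 mul1r norm_box_le1 // => u; apply: T1.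
Qed.

End Operator.

(** Functions of mean zero give small averages, by degree lowering for the
    normalised dual function; the hypothesis on the box products of [P] and [k]
    is what makes those of the dual function nearly orthogonal to
    nontrivial characters. *)
Lemma mean_zero_bound (R : realType) (s : nat) (C alpha K c : R) :
  0 < C -> 0 < alpha <= 1 -> 0 < K -> 0 < c ->
  exists K' c' : R, [/\ 0 < K', 0 < c' &
  forall (X : finZmodType) (Y : finType) (y0 : Y) (al : Y -> X)
    (P : X -> Y -> R[i]) (k : Y -> R[i]) (d : R),
  0 <= d <= 1 -> (forall x y, `|P x y| <= 1) -> (forall y, `|k y| <= 1) ->
  (forall g : X -> R[i], (forall x, `|g x| <= 1) ->
     L2norm (twisted_avg al P k g) <= C * (gowers_norm s.+1 g) `^ alpha + d) ->
  (forall phi : X -> R[i], is_character phi -> (exists x, phi x != 1) ->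
   forall h h' : seq X, size h = size h' ->
   L2norm (fun x => \E_(y in Y) (box (fun u => P (x + \sum_(b <- u) b) y) h h'
     * phi (al y) * box (fun _ => k y) h h')) <= K * d `^ c) ->
  forall g : X -> R[i], (forall x, `|g x| <= 1) -> \E_(x in X) g x = 0 ->
  L2norm (twisted_avg al P k g) <= K' * d `^ c'].
Proof.
move=> C0 /andP[al0 al1] K0 c0.
have [K1 [c1 [K1ge c1gt low]]] := degree_lowering s K0 c0.
pose e1 : R := c1 * (2 ^ s.+1)%:R^-1 * alpha.
have n0 : 0 < (2 ^ s.+1)%:R :> R by rewrite ltr0n expn_gt0.
have n1 : (2 ^ s.+1)%:R^-1 <= 1 :> R by rewrite invf_le1 // ler1n expn_gt0.
have e1gt : 0 < e1 by rewrite !mulr_gt0 // invr_gt0.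
pose c2 := Num.min e1 1.
have c2gt : 0 < c2 by rewrite lt_min e1gt ltr01.
have K10 : 0 < K1 by apply: lt_le_trans K1ge.
exists (2 * (C * K1 + 1)), (c2 * 4%:R^-1); split.
- by rewrite mulr_gt0 // addr_gt0 // mulr_gt0.
- by rewrite mulr_gt0 // invr_gt0 ltr0n.
move=> X Y y0 al P k d d01 P1 k1 ctrl equi g g1 g0.
have /andP[d0 d1] := d01.
set T0 := twisted_avg al P k g.
have T1 x : `|T0 x| <= 1 by exact: norm_twisted_avg.
pose G := dual_term al P k T0.
have G1 y z : `|G y z| <= 1 by exact: norm_dual_term.
pose Dz z := \E_(y in Y) G y z.
pose e := \E_(z in X) Dz z.
have Dz1 z : `|Dz z| <= 1 by exact: norm_expect_le.
have e1' : `|e| <= 1 by exact: norm_expect_le.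
(* [D' = (Dz - e) / 2] as an average of bounded functions: half of them are the
   [G y], the other half are the constant [- e], orthogonal to all nontrivial
   characters. *)
pose G' (p : bool * Y) z := if p.1 then G p.2 z else - e.
pose D' z := \E_(p in (bool * Y)%type) G' p z.
have G'1 p z : `|G' p z| <= 1 by rewrite /G'; case: p.1; rewrite ?normrN.
have D'1 z : `|D' z| <= 1 by exact: norm_expect_le.
have D'E z : D' z = 2^-1 * (Dz z - e).
  by rewrite /D' expect_pair expect_bool /= (expect_cst y0).
have ED' : \E_(z in X) D' z = 0.
  by rewrite (eq_expect D'E) expectMl expectB (expect_cst (0 : X)) subrr mulr0.
have equi' (phi : X -> R[i]) : is_character phi -> (exists x, phi x != 1) ->
   forall h h' : seq X, size h = size h' ->
     `|\E_(x in X) \E_(p in (bool * Y)%type) (phi x * box (pullsum (G' p) x) h h')|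
       <= (K * d `^ c)%:C.
  move=> phiC phi1 h h' sz.
  have [x1 x1P] := phi1.
  rewrite (eq_expect (g := fun x => 2^-1 *
    (\E_(y in Y) (phi x * box (pullsum (G y) x) h h') + phi x * box (fun _ => - e) h h'))).
    rewrite expectMl expectD expectMr (expect_character phiC x1P) mul0r addr0.
    rewrite normrM; apply: le_trans (ler_piMl _ _) _ => //.
      by rewrite ger0_norm ?invr_ge0 // invf_le1 // ler1n.
    apply: dual_equidistributed => //.
    apply: (equi _ (characterC phiC)) => //; exists x1.
    apply: contraNneq x1P => E; by rewrite -[phi x1]conjcK E conjc1.
  by move=> x; rewrite expect_pair expect_bool -[X in _ = _ * (_ + X)](expect_cst y0).
have := low X _ G' d d01 G'1 equi' ED'; rewrite -/D' => lowD.
have gn0 : 0 <= complex.Re (gowers_avg s.+1 D') by apply/Re_ge0/gowers_avg_ge0.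
have gn : (gowers_norm s.+1 D') `^ alpha <= K1 * d `^ e1.
  apply: powR_bound => //; [exact: powR_ge0|by rewrite al0|].
  by apply: powR_bound => //; rewrite invr_gt0 n0.
have LT : L2norm (twisted_avg al P k D') <= (C * K1 + 1) * d `^ c2.
  apply: le_trans (ctrl _ D'1) _; rewrite mulrDl mul1r -mulrA; apply: lerD.
    rewrite ler_pM2l //; apply: (le_trans gn); rewrite ler_pM2l //.
    by apply: powR_le1_anti => //; rewrite ge_min lexx.
  rewrite -{1}[d]powRr1 //; apply: powR_le1_anti => //.
  by rewrite ge_min lexx orbT.
have DzE z : Dz z = 2 * D' z + e by rewrite D'E mulrA divff ?mul1r ?subrK // pnatr_eq0.
have sqD' : 2 * \E_(z in X) `|D' z| ^+ 2 <= (L2norm (twisted_avg al P k D'))%:C.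
  have EQ : 2 * \E_(z in X) `|D' z| ^+ 2 =
     \E_(x in X) (conjc (T0 x) * twisted_avg al P k D' x).
    rewrite [RHS](eq_expect (g := fun x => twisted_avg al P k D' x * conjc (T0 x))); last first.
      by move=> x; rewrite mulrC.
    rewrite twisted_avg_adjoint -/G.
    rewrite [RHS](eq_expect (g := fun z => 2 * `|D' z| ^+ 2 + D' z * conjc e)).
      by rewrite expectD expectMl expectMr ED' mul0r addr0.
    move=> z; rewrite -/(Dz z) DzE (@conjc_lin R) sqr_normc; ring.
  have nn : 0 <= 2 * \E_(z in X) `|D' z| ^+ 2.
    by rewrite mulr_ge0 // expect_ge0 // => z; rewrite exprn_ge0.
  rewrite -(ger0_norm nn) EQ; apply: norm_expect_le_L2norm => x.
  by rewrite normcJ.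
have sqT : ((L2norm T0) ^+ 2)%:C = 2 * \E_(z in X) (g z * conjc (D' z)).
  rewrite L2norm_sqr (eq_expect (fun x => sqr_normc (T0 x))) twisted_avg_adjoint.
  rewrite -expectMl -/G -[LHS]subr0 -(mulr0 (conjc e)) -g0 -expectMl -expectB.
  apply: eq_expect => z; rewrite -/(Dz z) DzE (@conjc_lin R); ring.
have T4 : (L2norm T0) ^+ 4 <= 2 * L2norm (twisted_avg al P k D').
  rewrite -lecR (exprM _ 2 2) rmorphXn /=.
  have nn : 0 <= ((L2norm T0) ^+ 2)%:C :> R[i].
    by rewrite -[0 : R[i]]/(0%:C) lecR exprn_ge0 ?L2norm_ge0.
  rewrite -(ger0_norm nn) sqT normrM exprMn.
  apply: le_trans (_ : `|2| ^+ 2 * \E_(z in X) `|D' z| ^+ 2 <= _).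
    apply: ler_wpM2l; first by rewrite exprn_ge0.
    apply: le_trans (jensen_norm 1 _) _; apply: le_expect => z.
    rewrite expn1 normrM normcJ exprMn ler_piMl ?exprn_ge0 // exprn_ile1 //.
  rewrite ger0_norm // expr2 -mulrA rmorphM rmorph_nat.
  by apply: ler_wpM2l.
apply: root_bound => //; first exact: L2norm_ge0.
  have := mulr_gt0 C0 K10; lra.
apply: (le_trans T4); rewrite -mulrA ler_pM2l //.
Qed.

(** * The induction on the number of functions *)

Section OrdinalProducts.
Variables (K : comNzRingType) (m : nat) (i0 : 'I_m).
Implicit Types F : 'I_m -> K.

Lemma prod_ord_ltS F :
  \prod_(i < m | (i <= i0)%N) F i = F i0 * \prod_(i < m | (i < i0)%N) F i.
Proof.
rewrite (bigD1 i0) //=; congr (_ * _); apply: eq_bigl => i.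
by rewrite ltn_neqAle andbC -val_eqE.
Qed.

Lemma prod_ord_leS F :
  \prod_(i < m | (i0 <= i)%N) F i = F i0 * \prod_(i < m | (i0 < i)%N) F i.
Proof.
rewrite (bigD1 i0) //=; congr (_ * _); apply: eq_bigl => i.
by rewrite ltn_neqAle andbC -val_eqE eq_sym.
Qed.

End OrdinalProducts.

Lemma norm_prod_le1 (R : realType) (I : Type) (r : seq I) (P : pred I) (F : I -> R[i]) :
  (forall i, P i -> `|F i| <= 1) -> `|\prod_(i <- r | P i) F i| <= 1.
Proof.
move=> F1; elim/big_ind: _ => [|x y x1 y1|i /F1 //]; first by rewrite normr1.
by rewrite normrM mulr_ile1.
Qed.

Section MixedAverages.
Variables (R : realType) (m : nat) (G1 G2 : finZmodType) (a : 'I_m -> G2 -> G1).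
Local Notation C := R[i].
Implicit Types f chi : 'I_m -> G1 -> C.

(** The first [l] places are occupied by functions and the others by characters;
    for a character, [x] only contributes a factor of modulus 1, which is omitted. *)
Definition mixed_avg (l : nat) f chi (x : G1) : C :=
  \E_(y in G2) ((\prod_(i < m | (i < l)%N) f i (x + a i y)) *
                (\prod_(j < m | (l <= j)%N) chi j (a j y))).

Definition mixed_limit (l : nat) f chi : C :=
  (\prod_(i < m | (i < l)%N) \E_(z in G1) f i z) *
  [forall j : 'I_m, (l <= j)%N ==> [forall z, chi j z == 1]]%:R.

Definition gowers_control (C0 alpha d : R) (s : nat) : Prop :=
  forall (l : 'I_m) f chi,
    (forall i : 'I_m, (i <= l)%N -> disk_valued (f i)) ->
    (forall j : 'I_m, (l < j)%N -> is_character (chi j)) ->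
    L2norm (mixed_avg l.+1 f chi) <= C0 * (gowers_norm s (f l)) `^ alpha + d.

Definition character_equidistribution (d : R) : Prop :=
  forall chi, (forall i : 'I_m, is_character (chi i)) ->
    ~ (forall (i : 'I_m) (z : G1), chi i z = 1) ->
    Normc.normc (\E_(y in G2) \prod_(i < m) chi i (a i y)) <= d.

Lemma mixed_avg0_bound f chi d : 0 <= d -> character_equidistribution d ->
  (forall j, is_character (chi j)) ->
  L2norm (fun x => mixed_avg 0 f chi x - mixed_limit 0 f chi) <= d.
Proof.
move=> d0 equi chiC; set c := \E_(y in G2) \prod_(i < m) chi i (a i y).
have avgE x : mixed_avg 0 f chi x = c.
  by apply: eq_expect => y; rewrite big_pred0 // mul1r.
rewrite (eq_L2norm (g := fun _ => c - mixed_limit 0 f chi)); last first.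
  by move=> x; rewrite avgE.
apply: L2norm_le => //; rewrite (expect_cst (0 : G1)) rmorphXn /=.
rewrite lerXn2r ?nnegrE //; first by rewrite -[0 : C]/(0%:C) lecR.
rewrite /mixed_limit big_pred0 // mul1r.
case: (boolP [forall j, _]) => [/forallP triv|ntriv].
  have -> : c = 1.
    rewrite -[RHS](expect_cst (0 : G2)); apply: eq_expect => y.
    by apply: big1 => i _; have /forallP/(_ (a i y))/eqP := triv i.
  by rewrite subrr normr0 -[0 : C]/(0%:C) lecR.
rewrite subr0 norm_normc lecR; apply: equi => // triv.
by case/negP: ntriv; apply/forallP => j; apply/forallP => z; rewrite triv.
Qed.

Variable i0 : 'I_m.

Lemma mixed_avg_le f chi x : mixed_avg i0.+1 f chi x =
  twisted_avg (a i0) (fun x y => \prod_(i < m | (i < i0)%N) f i (x + a i y))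
    (fun y => \prod_(j < m | (i0 < j)%N) chi j (a j y)) (f i0) x.
Proof.
apply: eq_expect => y; congr (_ * _).
by rewrite (prod_ord_ltS i0 (fun i => f i (x + a i y))) mulrC.
Qed.

Lemma mixed_avg_lt f chi x : mixed_avg i0 f chi x =
  \E_(y in G2) (\prod_(i < m | (i < i0)%N) f i (x + a i y) * chi i0 (a i0 y) *
    \prod_(j < m | (i0 < j)%N) chi j (a j y)).
Proof.
apply: eq_expect => y.
by rewrite (prod_ord_leS i0 (fun j => chi j (a j y))) mulrA.
Qed.

(** A constant function is a multiple of the trivial character. *)
Lemma mixed_limitS f chi : mixed_limit i0.+1 f chi =
  (\E_(z in G1) f i0 z) *
  mixed_limit i0 f (fun j => if j == i0 then fun _ => 1 else chi j).
Proof.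
rewrite /mixed_limit (prod_ord_ltS i0 (fun i => \E_(z in G1) f i z)) -mulrA.
congr (_ * (_ * _%:R)); congr (nat_of_bool _); apply: eq_forallb => j.
case: eqP => [->|/eqP ne]; last first.
  by rewrite ltn_neqAle (_ : i0 != j :> nat) //; rewrite eq_sym.
by rewrite ltnn /=; apply/esym/implyP => _; apply/forallP.
Qed.

(** The inductive step, for one choice of the groups: [IH] and [mean0] are the
    conclusions of the induction hypothesis and of [mean_zero_bound] there.  The
    alternating products over boxes of functions and characters that [mean0]
    requires to be small are again averages of functions and characters, with
    [phi] in the place [i0], so that [IH] bounds them. *)
Lemma mixed_step (C0 alpha K c K' c' d : R) (s : nat) f chi :
  0 <= d <= 1 -> gowers_control C0 alpha d s.+1 ->
  0 < K -> 0 < c -> 0 < K' -> 0 < c' ->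
  (forall f chi, (forall i : 'I_m, (i < i0)%N -> disk_valued (f i)) ->
     (forall j : 'I_m, (i0 <= j)%N -> is_character (chi j)) ->
     L2norm (fun x => mixed_avg i0 f chi x - mixed_limit i0 f chi) <= K * d `^ c) ->
  (forall (al : G2 -> G1) (P : G1 -> G2 -> R[i]) (k : G2 -> R[i]),
   (forall x y, `|P x y| <= 1) -> (forall y, `|k y| <= 1) ->
   (forall g : G1 -> R[i], (forall x, `|g x| <= 1) ->
     L2norm (twisted_avg al P k g) <= C0 * (gowers_norm s.+1 g) `^ alpha + d) ->
   (forall phi : G1 -> R[i], is_character phi -> (exists x, phi x != 1) ->
    forall h h' : seq G1, size h = size h' ->
    L2norm (fun x => \E_(y in G2) (box (fun u => P (x + \sum_(b <- u) b) y) h h'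
     * phi (al y) * box (fun _ => k y) h h')) <= K * d `^ c) ->
   forall g : G1 -> R[i], (forall x, `|g x| <= 1) -> \E_(x in G1) g x = 0 ->
   L2norm (twisted_avg al P k g) <= K' * d `^ c') ->
  (forall i : 'I_m, (i <= i0)%N -> disk_valued (f i)) ->
  (forall j : 'I_m, (i0 < j)%N -> is_character (chi j)) ->
  L2norm (fun x => mixed_avg i0.+1 f chi x - mixed_limit i0.+1 f chi)
    <= (4 * K' + 2 * K) * d `^ Num.min c c'.
Proof.
move=> d01 ctrl K0 c0 K'0 c'0 IH mean0 fD chiC; have /andP[d0 d1] := d01.
pose P x y : C := \prod_(i < m | (i < i0)%N) f i (x + a i y).
pose k y : C := \prod_(j < m | (i0 < j)%N) chi j (a j y).
have f1 (i : 'I_m) : (i <= i0)%N -> forall x, `|f i x| <= 1.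
  by move=> /fD /disk_valuedE.
have P1 x y : `|P x y| <= 1 by apply: norm_prod_le1 => i /ltnW /f1.
have k1 y : `|k y| <= 1.
  by apply: norm_prod_le1 => j /chiC/is_characterP[_ ->].
have mean0' := mean0 (a i0) P k P1 k1.
pose mu := \E_(z in G1) f i0 z.
have mu1 : `|mu| <= 1 by apply: norm_expect_le => // z; apply: f1.
(* The factor [2^-1] makes [g] bounded by 1. *)
pose g z := 2^-1 * (f i0 z - mu).
have g1 z : `|g z| <= 1.
  rewrite normrM ger0_norm ?invr_ge0 // mulrC ler_pdivrMr // mul1r.
  apply: le_trans (ler_normB _ _) _; rewrite -[2]/(1 + 1) lerD // f1 //.
have g0 : \E_(z in G1) g z = 0.
  by rewrite expectMl expectB (expect_cst (0 : G1)) subrr mulr0.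
have Tg : L2norm (twisted_avg (a i0) P k g) <= K' * d `^ c'.
  apply: mean0' => // [u u1|phi phiC [x1 x1P] h h' sz].
    pose f' i := if i == i0 then u else f i.
    have f'i0 : f' i0 = u by rewrite /f' eqxx.
    have := ctrl i0 f' chi; rewrite f'i0 => H.
    rewrite (eq_L2norm (g := mixed_avg i0.+1 f' chi)).
      apply: H => // i ile; rewrite /f'; case: eqP => _; last exact: fD.
      by apply/disk_valuedE.
    move=> x; rewrite mixed_avg_le f'i0; apply: eq_expect => y.
    congr (_ * _ * _); apply: eq_bigr => i; rewrite /f'; case: eqP => // ->.
    by rewrite ltnn.
  pose f' i x := box (fun u => f i (x + \sum_(b <- u) b)) h h'.
  pose chi' j := if j == i0 then phi else fun v => box (fun _ : seq G1 => chi j v) h h'.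
  have := IH f' chi'; have -> : mixed_limit i0 f' chi' = 0.
    rewrite /mixed_limit; case: forallP => [triv|]; last by rewrite mulr0.
    have := triv i0; rewrite leqnn /chi' eqxx => /forallP/(_ x1).
    by rewrite (negPf x1P).
  move=> H.
  rewrite (eq_L2norm (g := fun x => mixed_avg i0 f' chi' x - 0)).
    apply: H => [i ilt|j jge].
      apply/disk_valuedE => x; apply: norm_box_le1 => u; exact: f1 (ltnW ilt) _.
    rewrite /chi'; case: eqP => // /eqP ne.
    have /is_characterP[cD c1] : is_character (chi j).
      by apply: chiC; rewrite ltn_neqAle jge andbT eq_sym.
    apply/is_characterP; split=> [x y|x]; last exact: norm_box1.
    by rewrite -boxM; apply: eq_box => u; apply: cD.
  move=> x; rewrite subr0 mixed_avg_lt; apply: eq_expect => y.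
  congr (_ * _ * _); last first.
  - rewrite (box_prod _ _ (fun j _ => chi j (a j y))); apply: eq_bigr => j.
    by rewrite /chi'; case: eqP => // ->; rewrite ltnn.
  - by rewrite /chi' eqxx.
  rewrite (box_prod _ _ (fun i u => f i (x + \sum_(b <- u) b + a i y))).
  by apply: eq_bigr => i _; apply: eq_box => u; rewrite addrAC.
pose chi1 j := if j == i0 then (fun _ : G1 => 1 : C) else chi j.
have T1 : L2norm (fun x => mixed_avg i0 f chi1 x - mixed_limit i0 f chi1) <= K * d `^ c.
  apply: IH => [i /ltnW|j jge]; first exact: fD.
  rewrite /chi1; case: eqP => [_|/eqP ne].
    by apply/is_characterP; split=> *; rewrite ?mulr1 ?normr1.
  by apply: chiC; rewrite ltn_neqAle jge andbT eq_sym.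
rewrite (eq_L2norm (g := fun x => 2 * twisted_avg (a i0) P k g x +
    mu * (mixed_avg i0 f chi1 x - mixed_limit i0 f chi1))); last first.
  move=> x; rewrite mixed_limitS -/mu -/chi1 mulrBr addrA; congr (_ - _).
  rewrite mixed_avg_le mixed_avg_lt -!expectMl -expectD; apply: eq_expect => y.
  rewrite /chi1 eqxx mulr1 -/(P x y) -/(k y).
  have -> : \prod_(j < m | (i0 < j)%N)
      (if j == i0 then (fun _ : G1 => 1 : C) else chi j) (a j y) = k y.
    by apply: eq_bigr => j; case: eqP => // ->; rewrite ltnn.
  by rewrite /g; field.
apply: le_trans (L2norm_lin (twisted_avg (a i0) P k g)
  (fun x => mixed_avg i0 f chi1 x - mixed_limit i0 f chi1) mu1) _.
rewrite [leRHS]mulrDl -(mulrA 4) -(mulrA 2); apply: lerD.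
  rewrite ler_pM2l //; apply: (le_trans Tg); rewrite ler_pM2l //.
  by apply: powR_le1_anti => //; rewrite ?lt_min ?c0 // ge_min lexx orbT.
rewrite ler_pM2l //; apply: (le_trans T1); rewrite ler_pM2l //.
by apply: powR_le1_anti => //; rewrite ?lt_min ?c0 // ge_min lexx.
Qed.

End MixedAverages.

Lemma mixed_avg_bound (R : realType) (m : nat) (C0 : R) (s : nat) (alpha : R) (l : nat) :
  0 < C0 -> 0 < alpha <= 1 -> (l <= m)%N ->
  exists K c : R, [/\ 0 < K, 0 < c &
  forall (G1 G2 : finZmodType) (a : 'I_m -> G2 -> G1) (d : R),
  0 <= d <= 1 -> gowers_control a C0 alpha d s.+1 -> character_equidistribution a d ->
  forall f chi : 'I_m -> G1 -> R[i],
  (forall i : 'I_m, (i < l)%N -> disk_valued (f i)) ->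
  (forall j : 'I_m, (l <= j)%N -> is_character (chi j)) ->
  L2norm (fun x => mixed_avg a l f chi x - mixed_limit l f chi) <= K * d `^ c].
Proof.
move=> C00 al01; elim: l => [|l IHl] lm.
  exists 1, 1; split=> // G1 G2 a d /andP[d0 d1] _ equi f chi _ chiC.
  rewrite mul1r powRr1 //; apply: mixed_avg0_bound => // j; exact: chiC.
have [K [c [K0 c0 IH]]] := IHl (ltnW lm).
have [K' [c' [K'0 c'0 mean0]]] := mean_zero_bound s C00 al01 K0 c0.
exists (4 * K' + 2 * K), (Num.min c c'); split.
- by rewrite addr_gt0 // mulr_gt0.
- by rewrite lt_min c0.
move=> G1 G2 a d d01 ctrl equi f chi fD chiC.
apply: (mixed_step (i0 := Ordinal lm) d01 ctrl) => // [f' chi'|al P k P1 k1].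
  exact: IH.
exact: (mean0 G1 G2 0 al P k d d01 P1 k1).
Qed.

Theorem theorem1p14 (R : realType) (m : nat) (C : R) (s : nat) (alpha : R)
    (hm : (1 <= m)%N) (hC : 0 < C) (hs : (1 <= s)%N)
    (halpha : 0 < alpha <= 1) :
  exists gamma1 gamma2 K : R,
    [/\ 0 < gamma1, 0 < gamma2, 0 < K &
    forall (G1 G2 : finZmodType) (a : 'I_m -> G2 -> G1) (delta1 delta2 : R),
      0 <= delta1 -> 0 <= delta2 ->
      (forall (l : 'I_m) (f chi : 'I_m -> G1 -> R[i]),
        (forall i : 'I_m, (i <= l)%N -> disk_valued (f i)) ->
        (forall j : 'I_m, (l < j)%N -> is_character (chi j)) ->
        L2norm (fun x : G1 =>
          \E_(y in G2) ((\prod_(i < m | (i <= l)%N) f i (x + a i y)) *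
                        (\prod_(j < m | (l < j)%N) chi j (a j y))))
        <= C * (gowers_norm s (f l)) `^ alpha + delta1) ->
      (forall chi : 'I_m -> G1 -> R[i],
        (forall i : 'I_m, is_character (chi i)) ->
        ~ (forall (i : 'I_m) (z : G1), chi i z = 1) ->
        Normc.normc (\E_(y in G2) \prod_(i < m) chi i (a i y)) <= delta2) ->
      forall f : 'I_m -> G1 -> R[i],
        (forall i : 'I_m, disk_valued (f i)) ->
        L2norm (fun x : G1 =>
          (\E_(y in G2) \prod_(i < m) f i (x + a i y)) -
          \prod_(i < m) \E_(z in G1) f i z)
        <= K * (delta1 `^ gamma1 + delta2 `^ gamma2)].
Proof.
case: s hs => // s _.
have [K [c [K0 c0 bound]]] := mixed_avg_bound s hC halpha (leqnn m).
exists c, c, (K + 2); split=> // [|G1 G2 a delta1 delta2 d10 d20 ctrl equi f fD].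
  by rewrite addr_gt0.
have p1 := powR_ge0 delta1 c; have p2 := powR_ge0 delta2 c.
have f1 i x : `|f i x| <= 1 by move: x; apply/disk_valuedE.
pose d := Num.max delta1 delta2.
have d0 : 0 <= d by rewrite le_max d10.
have dle : d `^ c <= delta1 `^ c + delta2 `^ c.
  by rewrite /d; case: (leP delta1 delta2) => _; rewrite ?lerDl ?lerDr.
case: (leP d 1) => [d1|/ltW d1].
  have d01 : 0 <= d <= 1 by rewrite d0.
  have ctrl' : gowers_control a C alpha d s.+1.
    move=> l f' chi' f'D chi'C; apply: le_trans (ctrl l f' chi' f'D chi'C) _.
    by rewrite lerD2l le_max lexx.
  have equi' : character_equidistribution a d.
    move=> chi' chi'C nt; apply: le_trans (equi chi' chi'C nt) _.
    by rewrite le_max lexx orbT.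
  pose chi (j : 'I_m) (z : G1) : R[i] := 1.
  have := bound G1 G2 a d d01 ctrl' equi' f chi (fun i _ => fD i).
  rewrite (eq_L2norm (g := fun x : G1 => (\E_(y in G2) \prod_(i < m) f i (x + a i y)) -
          \prod_(i < m) \E_(z in G1) f i z)); last first.
    move=> x; congr (_ - _); last first.
      rewrite /mixed_limit (_ : [forall j, _]) ?mulr1; last first.
        by apply/forallP => j; apply/implyP => _; apply/forallP => z.
      by apply: eq_bigl => i; rewrite ltn_ord.
    apply: eq_expect => y; rewrite [X in _ * X]big1 ?mulr1 //.
    by apply: eq_bigl => i; rewrite ltn_ord.
  move=> /(_ _)/le_trans; apply.
    by move=> j; rewrite leqNgt ltn_ord.
  apply: le_trans (_ : K * (delta1 `^ c + delta2 `^ c) <= _).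
    by rewrite ler_pM2l.
  by rewrite mulrDl lerDl mulr_ge0 // addr_ge0.
apply: le_trans (_ : 2 <= _).
  apply: L2norm_le => //; apply: expect_le_cst => [|x].
    by rewrite -[0 : R[i]]/(0%:C) lecR exprn_ge0.
  rewrite rmorphXn /= lerXn2r ?nnegrE //.
    by rewrite -[0 : R[i]]/(0%:C) lecR.
  apply: le_trans (ler_normB _ _) _; rewrite (_ : 2%:C = 1 + 1); last first.
    by rewrite -[2 : R]/(2%:R) rmorph_nat.
  apply: lerD; last by apply: norm_prod_le1 => i _; apply: norm_expect_le.
  by apply: norm_expect_le => // y; apply: norm_prod_le1 => i _.
have : 1 <= d `^ c.
  by rewrite -(powRr0 d); apply: ler_powR => //; exact: ltW.
move=> dc1; have : 1 <= delta1 `^ c + delta2 `^ c by apply: le_trans dle.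
nra.
Qed.
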